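(* Let $\tilde P_8$ and $\bar P_8$ be the eighth terms of the $\mathrm{U}$-Bott chain (starting with $\mathrm{U}_{16n}$) and of the $\mathrm{Sp}$-Bott chain (starting with $\mathrm{Sp}_{16n}$), constructed with the same base points, so that $\tilde P_8\subset\bar P_8$. Then there exists an isometry $\chi:\bar P_8\to\mathrm{Sp}_n$, where $\mathrm{Sp}_n$ carries a suitable positive constant multiple of its standard bi-invariant metric, which maps $\tilde P_8$ to $\mathrm{U}_n$ and makes the diagram $$\begin{array}{ccc}\tilde P_8&\xrightarrow{\ \chi|_{\tilde P_8}\ }&\mathrm{U}_n\\ \cap&&\cap\\ \bar P_8&\xrightarrow{\ \ \chi\ \ }&\mathrm{Sp}_n\end{array}$$ commutative, where $\mathrm{U}_n\subset\mathrm{Sp}_n$ is the standard inclusion.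
   Context: Groups. $\mathrm{Sp}_r$ is identified with the subgroup of $\mathrm{U}_{2r}$ of all unitary matrices of the form $\begin{pmatrix} A & -\overline{B} \\ B & \overline{A}\end{pmatrix}$ with $A,B$ complex $r\times r$ matrices; the standard inclusion $\mathrm{U}_r\subset\mathrm{Sp}_r$ identifies $\mathrm{U}_r$ with the subgroup of those with $B=0$, $A\in\mathrm{U}_r$. The standard metric on $\mathrm{Sp}_r$ is the one induced from the bi-invariant metric $\langle X,Y\rangle=-\frac12\mathrm{tr}(XY)$ on $\mathrm{U}_{2r}$; it restricts to $-\mathrm{tr}(XY)$ on $\mathrm{U}_r$. Centrioles. For a compact connected Riemannian symmetric space $P$ let $s_x$ be the geodesic symmetry at $x$. For $o\in P$, a pole of $(P,o)$ is a point $p\ne o$ with $s_p=s_o$. If $p$ is a pole, the centrosome $C_p(P,o)$ is the set of midpoints of geodesics in $P$ from $o$ to $p$; its connected components are the centrioles of $(P,o)$ relative to $p$. A centriole containing a midpoint of a shortest geodesic segment from $o$ to $p$ is called an s-centriole. Base points. $n\ge1$ is an integer, $P_0=\mathrm{SO}_{16n}$, $J_0=I$. $P_1$ is one of the two connected components of $\{J\in\mathrm{SO}_{16n}: J^2=-I\}$; inductively, having picked $J_k\in P_k$ ($1\le k\le 7$), $P_{k+1}$ is the top-dimensional connected component of $\{J\in P_k: JJ_k=-J_kJ\}$ (for $k=7$: any one of the two components). Finally $J_8\in P_8$. So $J_0,\dots,J_8\in\mathrm{SO}_{16n}\subset\mathrm{U}_{16n}\subset\mathrm{Sp}_{16n}$.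 $\mathrm{U}$-Bott chain. $\tilde P_0=\mathrm{U}_{16n}$ with metric $-\mathrm{tr}(XY)$; for $0\le k\le7$, $\tilde P_{k+1}$ is the top-dimensional s-centriole of $(\tilde P_k,J_k)$ relative to the pole $-J_k$ (one has $J_k\in P_k\subset\tilde P_k$). $\mathrm{Sp}$-Bott chain. $\bar P_0=\mathrm{Sp}_{16n}$ with the standard metric; for $0\le k\le 7$, $\bar P_{k+1}$ is the s-centriole of $(\bar P_k,J_k)$ relative to the pole $-J_k$ which contains $J_{k+1}$; one has $\tilde P_k\subset\bar P_k$ for all $k$. The spaces $\tilde P_8$, $\bar P_8$ carry the submanifold metrics. *)

(* Defs.v *)
From mathcomp Require Import all_boot all_order all_algebra.
From mathcomp Require Import complex.
From mathcomp Require Import all_classical all_reals all_analysis.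

Set Implicit Arguments.
Unset Strict Implicit.
Unset Printing Implicit Defensive.

Import Order.TTheory GRing.Theory Num.Theory.
Import numFieldNormedType.Exports.

Local Open Scope classical_set_scope.
Local Open Scope ring_scope.
Local Open Scope complex_scope.
Local Open Scope sesquilinear_scope.

(* Riemannian geometry of submanifolds [M] of a finite-dimensional real vector
   space [V] with inner product [dot], [M] carrying the induced metric. *)
Section Submanifolds.
Context {R : realType} {V : normedModType R}.
Implicit Types (M A C : set V) (x o p u v : V) (c : R -> V).

Definition tangent M x v : Prop :=
  exists c, [/\ forall t, M (c t), c 0 = x & is_derive (0 : R) 1 c v].

(* The tangent space at every point of [M] has a basis of [d] vectors. *)
Definition has_dim M (d : nat) : Prop :=
  forall x, M x -> exists e : 'I_d -> V,
    (forall a : 'I_d -> R, \sum_i a i *: e i = 0 -> forall i, a i = 0) /\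
    (forall v, tangent M x v <-> exists a : 'I_d -> R, v = \sum_i a i *: e i).

Definition components A : set (set V) :=
  [set connected_component A x | x in A].

Definition top_dimensional (F : set (set V)) C : Prop :=
  F C /\ exists2 d, has_dim C d &
    forall C' d', F C' -> has_dim C' d' -> (d' <= d)%N.

Variable dot : V -> V -> R.

(* The Levi-Civita covariant derivative of [c'] is the tangential part of
   [c''].  All the [M] considered are compact, so geodesics extend to all of
   [R]; a segment is their restriction to [0, 1]. *)
Definition geodesic M c : Prop :=
  [/\ forall t, M (c t),
      forall t : R, derivable c t 1,
      forall t : R, derivable (derive1 c) t 1
    & forall t v, tangent M (c t) v -> dot (derive1n 2 c t) v = 0].

Definition geodesic_segment M o p : set (R -> V) :=
  [set c | [/\ geodesic M c, c 0 = o & c 1 = p]].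

Definition arc_length c : R :=
  \int[lebesgue_measure]_(t in `[0, 1]) Num.sqrt (dot (derive1 c t) (derive1 c t)).

Definition shortest_geodesic_segment M o p : set (R -> V) :=
  [set c | geodesic_segment M o p c /\
    forall c', geodesic_segment M o p c' -> arc_length c <= arc_length c'].

Definition midpoint c : V := c 2^-1.

(* Every point of [M] lies on a geodesic through [x] when [M] is complete and
   connected, so this determines [s] on [M]. *)
Definition geodesic_symmetry M x (s : V -> V) : Prop :=
  forall c, geodesic M c -> c 0 = x -> forall t, s (c t) = c (- t).

Definition pole M o p : Prop :=
  [/\ M p, p <> o &
      exists s, geodesic_symmetry M o s /\ geodesic_symmetry M p s].

Definition centrosome M o p : set V :=
  [set midpoint c | c in geodesic_segment M o p].

Definition centriole M o p : set (set V) :=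
  [set C | pole M o p /\ components (centrosome M o p) C].

Definition s_centriole M o p : set (set V) :=
  [set C | centriole M o p C /\
    exists2 c, shortest_geodesic_segment M o p c & C (midpoint c)].

End Submanifolds.

Section Isometries.
Context {R : realType} {V W : normedModType R}.

Fixpoint Ck (k : nat) (f : V -> W) : Prop :=
  if k is k'.+1 then
    (forall x, differentiable f x) /\ (forall v, Ck k' (fun x => 'D_v f x))
  else continuous f.

Definition smooth (f : V -> W) : Prop := forall k, Ck k f.

End Isometries.

(* A map between closed submanifolds is smooth if and only if it is the
   restriction of a smooth map of the ambient spaces; [f] and [g] are such
   extensions of the isometry [M -> N] and of its inverse. *)
Definition riemannian_isometry {R : realType} {V W : normedModType R}
    (dotV : V -> V -> R) (dotW : W -> W -> R)
    (M : set V) (N : set W) (f : V -> W) : Prop :=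
  [/\ smooth f,
      exists g : W -> V,
        [/\ smooth g, {homo g : y / N y >-> M y},
            forall x, M x -> g (f x) = x & forall y, N y -> f (g y) = y],
      {homo f : x / M x >-> N x}
    & forall x u v, M x -> tangent M x u -> tangent M x v ->
        dotW ('D_u f x) ('D_v f x) = dotV u v].

(* Complex [m x m] matrices as a real normed space: (real, imaginary) part. *)
Definition cmat (R : realType) (m : nat) : normedModType R :=
  ('M[R]_m * 'M[R]_m)%type.

Section Groups.
Context {R : realType}.

Definition cplx {m} (x : cmat R m) : 'M[R[i]]_m :=
  \matrix_(i, j) (x.1 i j +i* x.2 i j).

Definition conj_mx {m} (A : 'M[R[i]]_m) : 'M[R[i]]_m := map_mx Num.conj A.

Definition SO (r : nat) : set 'M[R]_r :=
  [set A | A *m A^T = 1%:M /\ \det A = 1].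

Definition Sp (r : nat) : set (cmat R (r + r)) :=
  [set x | cplx x \is unitarymx /\
    exists A B : 'M[R[i]]_r, cplx x = block_mx A (- conj_mx B) B (conj_mx A)].

Definition U (r : nat) : set (cmat R (r + r)) :=
  [set x | exists2 A : 'M[R[i]]_r, A \is unitarymx &
    cplx x = block_mx A 0 0 (conj_mx A)].

(* The inclusion of SO_r into Sp_r through U_r. *)
Definition so_incl {r} (A : 'M[R]_r) : cmat R (r + r) := (block_mx A 0 0 A, 0).

(* The Euclidean inner product whose restriction to the tangent spaces of the
   unitary group is the bi-invariant metric [- tr (X Y) / 2]; see
   [dot_unitary]. *)
Definition dot {m} (x y : cmat R m) : R :=
  complex.Re (\tr ((cplx x)^t* *m cplx y)) / 2.

End Groups.

Arguments SO {R} r _.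
Arguments Sp {R} r _.
Arguments U {R} r _.

Section Identifications.
Context {R : realType}.

Lemma dot_unitary m (g X Y : 'M[R[i]]_m) (x y : cmat R m) :
    g \is unitarymx -> X^t* = - X -> Y^t* = - Y ->
    cplx x = g *m X -> cplx y = g *m Y ->
  (dot x y)%:C = - \tr (X *m Y) / 2.
Proof.
move=> gU Xs Ys xE yE; rewrite /dot xE yE.
have -> : (g *m X) ^t* *m (g *m Y) = - (X *m Y).
  rewrite trmx_mul map_mxM Xs -mulmxA (mulmxA _ g).
  have -> : g ^t* *m g = 1%:M.
    apply: mulmx1C; exact/unitarymxP.
  by rewrite mul1mx mulNmx.
have trR : (\tr (X *m Y))^* = \tr (X *m Y).
  have -> : (\tr (X *m Y))^* = \tr ((X *m Y)^t*).
    by rewrite -[in RHS]map_trmx mxtrace_tr trace_map_mx.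
  by rewrite trmx_mul map_mxM Xs Ys mulNmx mulmxN opprK mxtrace_mulC.
rewrite raddfN /=; move: (\tr _) trR => -[a b] /= [] /eqP.
rewrite eq_sym -subr_eq0 opprK -mulr2n mulrn_eq0 /= => /eqP ->.
rewrite rmorphM /= fmorphV /= rmorph_nat.
by congr (_ / _); apply/eqP; rewrite eq_complex /= oppr0 !eqxx.
Qed.

Lemma cplx_so_incl (r : nat) (A : 'M[R]_r) :
  cplx (so_incl A) =
    block_mx (map_mx (real_complex R) A) 0 0 (map_mx (real_complex R) A).
Proof.
apply/matrixP => i j; rewrite !mxE.
by case: splitP => k _; rewrite !mxE; case: splitP => l _; rewrite !mxE.
Qed.

End Identifications.

Section Chains.
Context {R : realType} {n : nat}.
Local Notation r := (16 * n)%N.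

(* For [k = 7] both components have the top dimension: [P 8] is either one. *)
Definition base_points (P : nat -> set 'M[R]_r) (J : nat -> 'M[R]_r) : Prop :=
  [/\ P 0%N = SO r /\ J 0%N = 1%:M,
      components [set A | SO r A /\ A *m A = - 1%:M] (P 1%N),
      forall k, (1 <= k <= 7)%N ->
        top_dimensional
          (components [set A | P k A /\ A *m J k = - (J k *m A)]) (P k.+1)
    & forall k, (k <= 8)%N -> P k (J k)].

Definition U_Bott_chain (J : nat -> 'M[R]_r)
    (Pt : nat -> set (cmat R (r + r))) : Prop :=
  Pt 0%N = U r /\
  forall k, (k <= 7)%N ->
    top_dimensional
      (s_centriole dot (Pt k) (so_incl (J k)) (- so_incl (J k))) (Pt k.+1).

Definition Sp_Bott_chain (J : nat -> 'M[R]_r)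
    (Pb : nat -> set (cmat R (r + r))) : Prop :=
  Pb 0%N = Sp r /\
  forall k, (k <= 7)%N ->
    s_centriole dot (Pb k) (so_incl (J k)) (- so_incl (J k)) (Pb k.+1) /\
    Pb k.+1 (so_incl (J k.+1)).

End Chains.

(* Main.v *)
From HB Require Import structures.
Require Import Defs.
From mathcomp Require Import all_boot all_order all_algebra.
From mathcomp Require Import complex ring zify.
From mathcomp Require Import all_classical all_reals all_analysis.

Set Implicit Arguments.
Unset Strict Implicit.
Unset Printing Implicit Defensive.

Import Order.TTheory GRing.Theory Num.Theory.
Import numFieldNormedType.Exports.

Local Open Scope classical_set_scope.
Local Open Scope ring_scope.

(* Realify all matrices, so that U_r and Sp_r become the orthogonal matrices
   commuting with a fixed family of structures.  Let A_k be the set of those X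
   in the group with X^2 = -1 (for k > 0) and X J_i = - J_i X for 0 < i < k.
   A geodesic g of a union of components of A_k satisfies (g^-1 g')' = 0, hence
   g(1) = g(1/2) g(0)^-1 g(1/2), so a midpoint between J_k and - J_k
   anticommutes with J_k (for k = 0: squares to - 1); conversely every such m
   is the midpoint of the great circle cos(pi t) J_k + sin(pi t) m.  Thus the
   (k+1)-st term of a chain is a component of A_(k+1).
   Next, X in A_8 is h J_8 with h commuting with J_1, ..., J_7 and
   J_8 h J_8^-1 = h^-1.  The commuting involutions J_1 J_2 J_3, J_1 J_4 J_5,
   J_2 J_4 J_6 and J_1 ... J_7 have 16 joint eigenspaces, permuted by the J_i
   and hence all of dimension n; h is determined by its restriction to one of
   them, which is an arbitrary element of U_n or Sp_n.  This gives a linear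
   bijection of A_8 onto the group, which is connected, so that A_8 is its own
   only component. *)

(** * Curves of matrices *)

(** The algebra generated by [J_1, ..., J_7] acts on each eigenspace of [w = J_1 ... J_7] as all
    real 8 by 8 matrices, and a joint eigenspace is the range of a primitive idempotent of it. Hence
    an operator commuting with these generators is, where [w = 1], eight copies of an arbitrary
    operator on one joint eigenspace. [J_8] exchanges the eigenspaces of [w], and
    [J_8 h J_8^-1 = h^-1] dictates the other half. Writing [h^-1] as [h^T] makes the parametrisation
    and its inverse linear on the ambient matrix spaces: smoothness and the action on tangent
    vectors are then immediate, and one formula serves U and Sp. The 16 joint eigenspaces contribute
    equally to the trace form, whence the factor 16 in the metric. The intermediate stages may be
    disconnected. What passes from each stage to the next is only that a term of the chain is a
    nonempty union of components; the connectedness of the eighth stage then pins the last term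
    down, which is why connectedness of U_n and Sp_n has to be proved. *)

Section Curves.
Context {R : realType}.
Implicit Types V W : normedModType R.

Lemma mx_linear_continuous p q W (f : 'M[R]_(p, q) -> W) :
  linear f -> continuous f.
Proof.
move=> fl; pose fL := GRing.isLinear.Build _ _ _ _ _ fl.
pose g : {linear 'M[R]_(p, q) -> W} := HB.pack f fL.
have -> : f = fun x => \sum_i \sum_j x i j *: f (delta_mx i j).
  apply/funext => x; rewrite -[f x]/(g x) {1}(matrix_sum_delta x) linear_sum.
  apply: eq_bigr => i _; rewrite linear_sum; apply: eq_bigr => j _.
  by rewrite linearZ.
apply: continuous_big => [|i _]; first exact: add_continuous.
apply: continuous_big => [|j _ x]; first exact: add_continuous.
apply: (@continuous_comp _ _ _ (fun M : 'M[R]_(p, q) => M i j)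
  ( *:%R^~ (f (delta_mx i j)))); first exact: coord_continuous.
exact: scalel_continuous.
Qed.

Lemma cmat_linear_continuous m W (f : cmat R m -> W) : linear f -> continuous f.
Proof.
move=> fl; pose fL := GRing.isLinear.Build _ _ _ _ _ fl.
pose g : {linear cmat R m -> W} := HB.pack f fL.
have -> : f = fun x => f (x.1, 0) + f (0, x.2).
  apply/funext => x.
  rewrite -[f x]/(g x) -[f (x.1, 0)]/(g _) -[f (0, _)]/(g _) -linearD.
  by congr (g _); case: x => a b; congr pair; rewrite ?addr0 ?add0r.
move=> x; apply: cvgD.
- apply: (@continuous_comp _ _ _ fst (fun y : 'M[R]_m => f (y, 0))).
    exact: cvg_fst.
  apply: mx_linear_continuous => a u v /=; rewrite -fl; congr f.
  by congr pair; rewrite /= scaler0 addr0.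
- apply: (@continuous_comp _ _ _ snd (fun y : 'M[R]_m => f (0, y))).
    exact: cvg_snd.
  apply: mx_linear_continuous => a u v /=; rewrite -fl; congr f.
  by congr pair; rewrite /= scaler0 addr0.
Qed.

Lemma linear_is_derive V W (f : V -> W) (c : R -> V) (t : R) v :
  linear f -> continuous f -> is_derive t 1 c v -> is_derive t 1 (f \o c) (f v).
Proof.
move=> fl fc cv; pose fL := GRing.isLinear.Build _ _ _ _ _ fl.
pose g : {linear V -> W} := HB.pack f fL.
have /derivable1_diffP cd := @ex_derive _ _ _ _ _ _ _ cv.
have gd : differentiable g (c t) by exact: linear_differentiable.
have fcd : differentiable (f \o c) t by exact: differentiable_comp.
apply: DeriveDef; first exact/derivable1_diffP.
rewrite deriveE// diff_comp//= (@diff_lin _ _ _ g)// -deriveE//.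
by rewrite (@derive_val _ _ _ _ _ _ _ cv).
Qed.

Lemma is_derive_mxP p q (f : R -> 'M[R]_(p, q)) (t : R) df :
  is_derive t 1 f df <->
  forall i j, is_derive t 1 (fun s => f s i j) (df i j).
Proof.
split=> [fd i j|fd].
  apply: (@linear_is_derive _ _ (fun x : 'M[R]_(p, q) => x i j) f t df) => //.
    by move=> a u v; rewrite !mxE.
  exact: coord_continuous.
have fD : derivable f t 1 by apply/derivable_mxP => i j; case: (fd i j).
apply: DeriveDef => //; rewrite derive_mx//; apply/matrixP => i j.
by rewrite mxE; case: (fd i j).
Qed.

Lemma is_derive_mulmx p q s (f : R -> 'M[R]_(p, q)) (g : R -> 'M[R]_(q, s))
    (t : R) df dg :
  is_derive t 1 f df -> is_derive t 1 g dg ->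
  is_derive t 1 (fun x => f x *m g x) (df *m g t + f t *m dg).
Proof.
move=> /is_derive_mxP fd /is_derive_mxP gd; apply/is_derive_mxP => i j.
pose h k := (fun x => f x i k) * (fun x => g x k j).
have -> : (fun x => (f x *m g x) i j) = \sum_k h k.
  by apply/funext => x; rewrite mxE fct_sumE.
have hd k := is_deriveM (fd i k) (gd k j).
have := is_derive_sum hd; congr (is_derive _ _ _ _).
rewrite !mxE -big_split/=; apply: eq_bigr => k _.
by rewrite addrC; congr (_ + _); rewrite /GRing.scale/= mulrC.
Qed.

Lemma is_derive_trmx p q (f : R -> 'M[R]_(p, q)) (t : R) df :
  is_derive t 1 f df -> is_derive t 1 (fun x => (f x)^T) df^T.
Proof.
move=> /is_derive_mxP fd; apply/is_derive_mxP => i j; rewrite mxE.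
by under eq_fun do rewrite mxE.
Qed.

Lemma is_derive_unique V (f : R -> V) (t : R) u v :
  is_derive t 1 f u -> is_derive t 1 f v -> u = v.
Proof. by move=> [_ <-] [_ <-]. Qed.

Lemma eq_is_derive V (f g : R -> V) (t : R) df dg :
  (forall t, f t = g t) -> is_derive t 1 f df -> is_derive t 1 g dg -> df = dg.
Proof. by move=> /funext -> ; apply: is_derive_unique. Qed.

Lemma is_derive_mulmxl p q s (f : R -> 'M[R]_(p, q)) (A : 'M[R]_(s, p))
    (t : R) df :
  is_derive t 1 f df -> is_derive t 1 (fun x => A *m f x) (A *m df).
Proof.
move=> fd; have := is_derive_mulmx (is_derive_cst A t 1) fd.
by rewrite mul0mx add0r.
Qed.

Lemma is_derive_mulmxr p q s (f : R -> 'M[R]_(p, q)) (A : 'M[R]_(q, s))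
    (t : R) df :
  is_derive t 1 f df -> is_derive t 1 (fun x => f x *m A) (df *m A).
Proof.
move=> fd; have := is_derive_mulmx fd (is_derive_cst A t 1).
by rewrite mulmx0 addr0.
Qed.

Lemma is_derive_translate V (f : R -> V) (t a : R) df :
  is_derive (t + a) 1 f df -> is_derive t 1 (fun x => f (x + a)) df.
Proof.
move=> [fd <-].
have E : (fun h : R =>
    h^-1 *: (((fun x => f (x + a)) \o shift t) (h *: 1) - f (t + a))) =
    (fun h : R => h^-1 *: ((f \o shift (t + a)) (h *: 1) - f (t + a))).
  by apply/funext => h; rewrite /= addrA.
by split; [rewrite /derivable E|rewrite /derive E].
Qed.

Lemma is_derive_0_mx_cst p q (f : R -> 'M[R]_(p, q)) :
  (forall t : R, is_derive t 1 f 0) -> forall x y, f x = f y.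
Proof.
move=> fd x y; apply/matrixP => i j.
apply: (@is_derive_0_is_cst _ (fun t => f t i j)) => t.
by have /is_derive_mxP /(_ i j) := fd t; rewrite mxE.
Qed.

Lemma is_derive_scalel V (f : R -> R) (v : V) (t : R) df :
  is_derive t 1 f df -> is_derive t 1 (fun x => f x *: v) (df *: v).
Proof.
move=> fd; apply: (@linear_is_derive R V ( *:%R^~ v)) => //.
  by move=> a x y; rewrite /= scalerDl scalerA.
exact: scalel_continuous.
Qed.

Lemma derivable_curve_continuous V (f : R -> V) :
  (forall t : R, derivable f t 1) -> continuous f.
Proof.
move=> fd t; apply: differentiable_continuous.
exact/derivable1_diffP.
Qed.

Lemma connected_range V (f : R -> V) : continuous f -> connected (range f).
Proof.
move=> fc; apply: connected_continuous_connected.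
  by apply/connected_intervalP => x y _ _ z _.
exact: continuous_subspaceT.
Qed.

End Curves.

(** * The Cayley transform *)

Section Cayley.
Context {R : realType}.

(** The trace is the sum of the squares of the entries of [A]; this positivity is what realification
    buys. *)
Lemma trace_mulmx_tr_eq0 p q (A : 'M[R]_(p, q)) : \tr (A *m A^T) = 0 -> A = 0.
Proof.
move=> tr0; apply/matrixP => i j; rewrite mxE.
have sq_ge0 (k : 'I_p) (l : 'I_q) : true -> 0 <= A k l * A k l.
  by move=> _; rewrite -expr2 sqr_ge0.
have /psumr_eq0P H : \sum_k \sum_l A k l * A k l = 0.
  rewrite -[RHS]tr0; apply: eq_bigr => k _.
  by rewrite mxE; apply: eq_bigr => l _; rewrite mxE.
have /psumr_eq0P Hi := H (fun k _ => sumr_ge0 _ (sq_ge0 k)) i isT.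
by have /eqP := Hi (sq_ge0 i) j isT; rewrite mulf_eq0 orbb => /eqP.
Qed.

Lemma mulmx_tr_eq0 p q (A : 'M[R]_(p, q)) : A *m A^T = 0 -> A = 0.
Proof. by move=> A0; apply: trace_mulmx_tr_eq0; rewrite A0 mxtrace0. Qed.

Lemma row_normalize N (v : 'rV[R]_N) : v != 0 ->
  exists2 a : R, a != 0 & (a *: v) *m (a *: v)^T = 1%:M.
Proof.
move=> v0; pose c := (v *m v^T) 0 0.
have c0 : 0 < c.
  rewrite lt_neqAle eq_sym; apply/andP; split.
    apply/eqP => c0; case/eqP: v0; apply: mulmx_tr_eq0.
    by rewrite [_ *m _]mx11_scalar -/c c0 raddf0.
  by rewrite /c mxE sumr_ge0// => i _; rewrite mxE -expr2 sqr_ge0.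
exists (Num.sqrt c)^-1; first by rewrite invr_eq0 sqrtr_eq0 -ltNge.
rewrite linearZ/= -scalemxAl -scalemxAr scalerA -invfM -expr2.
rewrite sqr_sqrtr ?ltW// [v *m _]mx11_scalar -/c scale_scalar_mx mulVf//.
by rewrite gt_eqF.
Qed.

Lemma skew_quadratic_form N (Y : 'M[R]_N) (v : 'rV[R]_N) :
  Y^T = - Y -> v *m Y *m v^T = 0.
Proof.
move=> Ys; apply/matrixP => i j; rewrite !ord1.
have /(congr1 (fun M : 'M[R]_1 => M 0 0)) : (v *m Y *m v^T)^T = - (v *m Y *m v^T).
  by rewrite !trmx_mul trmxK Ys mulNmx mulmxN mulmxA.
by rewrite !mxE => /eqP; rewrite -subr_eq0 opprK -mulr2n mulrn_eq0 /= => /eqP.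
Qed.

Lemma sym_skew_trace N (A B : 'M[R]_N) : A^T = A -> B^T = - B -> \tr (A *m B) = 0.
Proof.
move=> As Bs; have : \tr (A *m B) = - \tr (A *m B).
  by rewrite -{1}mxtrace_tr trmx_mul As Bs mulNmx raddfN/= mxtrace_mulC.
by move=> /eqP; rewrite -addr_eq0 -mulr2n mulrn_eq0 /= => /eqP.
Qed.

(** A row fixed by [Y] would satisfy [v v^T = v Y v^T = 0]. *)
Lemma skew_unitmx N (Y : 'M[R]_N) : Y^T = - Y -> 1%:M - Y \in unitmx.
Proof.
move=> Ys; rewrite -row_free_unit; apply/inj_row_free => v.
rewrite mulmxBr mulmx1 => /eqP; rewrite subr_eq0 => /eqP vY.
by apply: mulmx_tr_eq0; rewrite {1}vY skew_quadratic_form.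
Qed.

Variable N : nat.
Implicit Types (Y Z : 'M[R]_N) (s : R).

(** Rational stand-in for [exp (2 s Y)]: orthogonal for skew [Y], with the same velocity at 0, and
    differentiable by algebra alone. *)
Definition cayley Y s : 'M[R]_N := invmx (1%:M - s *: Y) *m (1%:M + s *: Y).

Lemma skewZ Y s : Y^T = - Y -> (s *: Y)^T = - (s *: Y).
Proof. by move=> Ys; rewrite linearZ /= Ys scalerN. Qed.

Lemma cayley_denom_unit Y s : Y^T = - Y -> 1%:M - s *: Y \in unitmx.
Proof. by move=> Ys; apply/skew_unitmx/skewZ. Qed.

Lemma cayley0 Y : cayley Y 0 = 1%:M.
Proof. by rewrite /cayley !scale0r subr0 addr0 mulmx1 invmx1. Qed.

Lemma mul_cayley Y s : Y^T = - Y ->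
  (1%:M - s *: Y) *m cayley Y s = 1%:M + s *: Y.
Proof. by move=> Ys; rewrite mulmxA mulmxV ?mul1mx// cayley_denom_unit. Qed.

Lemma cayley_uniq Y s Z : Y^T = - Y ->
  (1%:M - s *: Y) *m Z = 1%:M + s *: Y -> Z = cayley Y s.
Proof.
move=> Ys e; rewrite /cayley -e mulmxA mulVmx ?mul1mx//.
exact: cayley_denom_unit.
Qed.

Lemma cayley_commute Y s Z : Y^T = - Y -> Y *m Z = Z *m Y ->
  cayley Y s *m Z = Z *m cayley Y s.
Proof.
move=> Ys YZ; have U := cayley_denom_unit s Ys.
apply: (can_inj (mulKmx U)); rewrite mulmxA mul_cayley// mulmxA.
rewrite [in RHS]mulmxBl mul1mx -scalemxAl YZ.
have -> : Z - s *: (Z *m Y) = Z *m (1%:M - s *: Y).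
  by rewrite mulmxBr mulmx1 -scalemxAr.
by rewrite -mulmxA mul_cayley// mulmxDl mulmxDr mul1mx mulmx1 -scalemxAl
  -scalemxAr YZ.
Qed.

(** Moving [Z] past [Y] changes the sign of [Y], which amounts to changing that of [s]. *)
Lemma cayley_anticommute Y s Z : Y^T = - Y -> Y *m Z = - (Z *m Y) ->
  cayley Y s *m Z = Z *m cayley Y (- s).
Proof.
move=> Ys YZ; have U := cayley_denom_unit s Ys.
apply: (can_inj (mulKmx U)); rewrite mulmxA mul_cayley// mulmxA.
rewrite [in RHS]mulmxBl mul1mx -scalemxAl YZ.
have -> : Z - s *: (- (Z *m Y)) = Z *m (1%:M - (- s) *: Y).
  by rewrite mulmxBr mulmx1 -scalemxAr scaleNr scalerN.
by rewrite -mulmxA mul_cayley// mulmxDl mulmxDr mul1mx mulmx1 -scalemxAl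
  -scalemxAr YZ scaleNr scalerN.
Qed.

Lemma cayley_tr Y s : Y^T = - Y -> (cayley Y s)^T = cayley Y (- s).
Proof.
move=> Ys; apply: cayley_uniq => //.
have com : (1%:M + s *: Y) *m (1%:M - s *: Y) =
           (1%:M - s *: Y) *m (1%:M + s *: Y).
  by rewrite mulmxBr mulmxDr !mulmx1 !mulmxDl !mul1mx mulNmx opprD addrA addrK
    addrA subrK.
rewrite /cayley trmx_mul trmx_inv !linearD/= linearN/= trmx1 skewZ// opprK.
rewrite !scaleNr opprK mulmxA com -mulmxA mulmxV ?mulmx1//.
by have := cayley_denom_unit (- s) Ys; rewrite scaleNr opprK.
Qed.

Lemma cayleyN Y s : Y^T = - Y -> cayley Y s *m cayley Y (- s) = 1%:M.
Proof.
move=> Ys; rewrite -cayley_commute//; last first.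
  by rewrite cayley_commute.
rewrite /cayley !scaleNr opprK; set A := _ - _; set B := _ + _.
have UA : A \in unitmx by exact: cayley_denom_unit.
have UB : B \in unitmx.
  by have := cayley_denom_unit (- s) Ys; rewrite scaleNr opprK.
by rewrite mulmxA -(mulmxA _ A) mulmxV// mulmx1 mulVmx.
Qed.

Lemma cayley_orth Y s : Y^T = - Y -> cayley Y s *m (cayley Y s)^T = 1%:M.
Proof. by move=> Ys; rewrite cayley_tr// cayleyN. Qed.

Lemma is_derive_affine Y Z s : is_derive s 1 (fun x : R => Z + x *: Y) Y.
Proof.
have : is_derive s 1 (cst Z + (fun x : R => x *: Y)) (0 + 1 *: Y).
  by apply: is_deriveD; exact: is_derive_scalel.
by rewrite add0r scale1r.
Qed.

(** Cramer's rule: the entries of the inverse are cofactors, polynomial in the parameter, divided by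
    a determinant without real roots. *)
Lemma cayley_derivable Y s : Y^T = - Y -> derivable (cayley Y) s 1.
Proof.
move=> Ys.
pose P : 'M[{poly R}]_N := 1%:M - 'X *: map_mx polyC Y.
have PE x : map_mx (horner_eval x) P = 1%:M - x *: Y.
  rewrite /P raddfB /= map_mx1; congr (_ - _); apply/matrixP => i j.
  by rewrite !mxE /horner_eval hornerM hornerX hornerC.
have detE x : \det (1%:M - x *: Y) = (\det P).[x] by rewrite -PE det_map_mx.
have detN0 x : (\det P).[x] != 0.
  by rewrite -detE -unitfE -unitmxE cayley_denom_unit.
have invD : derivable (fun x : R => invmx (1%:M - x *: Y)) s 1.
  apply/derivable_mxP => i j.
  have -> : (fun x => invmx (1%:M - x *: Y) i j) =
      (fun x => (horner (\det P) x)^-1) * horner ((\adj P) i j).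
    apply/funext => x; rewrite fctE /= /invmx cayley_denom_unit// mxE detE.
    by rewrite -PE -map_mx_adj mxE.
  apply: derivableM; last exact: derivable_horner.
  by apply: derivableV; [exact: detN0|exact: derivable_horner].
by have [] := is_derive_mulmx (derivableP invD) (is_derive_affine Y 1%:M s).
Qed.

(** Differentiating [(1 - x Y) cayley Y x = 1 + x Y] at 0 avoids a formula for the derivative of the
    inverse. *)
Lemma cayley_is_derive0 Y : Y^T = - Y -> is_derive (0 : R) 1 (cayley Y) (Y + Y).
Proof.
move=> Ys; have cD := derivableP (cayley_derivable (s := 0) Ys).
have := is_derive_mulmx (is_derive_affine (- Y) 1%:M 0) cD.
have -> : (fun x : R => (1%:M + x *: - Y) *m cayley Y x) =
          (fun x => 1%:M + x *: Y).
  by apply/funext => x; rewrite scalerN mul_cayley.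
move=> /is_derive_unique /(_ (is_derive_affine Y 1%:M 0)).
rewrite scale0r addr0 mul1mx cayley0 mulmx1 => /eqP.
by rewrite addrC subr_eq => /eqP <-.
Qed.

End Cayley.

(** * Geodesics and centrosomes *)

Section Realification.
Context {R : realType} {m : nat}.

Definition realmx (x : cmat R m) : 'M[R]_(m + m) := block_mx x.1 (- x.2) x.2 x.1.

(* Left inverse of [realmx], junk outside the commutant of [imx]. *)
Definition unreal (X : 'M[R]_(m + m)) : cmat R m := (ulsubmx X, dlsubmx X).

Definition imx : 'M[R]_(m + m) := block_mx 0 (- 1%:M) 1%:M 0.

Lemma realmx_linear : linear realmx.
Proof.
move=> a x y; rewrite /realmx scale_block_mx add_block_mx /=.
by rewrite scalerN opprD.
Qed.

Lemma unreal_linear : linear unreal.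
Proof.
move=> a x y; rewrite /unreal; apply: injective_projections => /=;
by apply/matrixP => i j; rewrite !mxE.
Qed.

Lemma unreal_continuous : continuous unreal.
Proof. exact/mx_linear_continuous/unreal_linear. Qed.

Lemma realmxK : cancel realmx unreal.
Proof. by case=> a b; rewrite /unreal block_mxKul block_mxKdl. Qed.

Lemma realmx_imx x : realmx x *m imx = imx *m realmx x.
Proof.
rewrite /realmx /imx !mulmx_block !(mulmx0, mul0mx, mulmx1, mul1mx, addr0, add0r).
by rewrite !(mulmxN, mulNmx, mulmx1, mul1mx).
Qed.

Lemma unrealK X : X *m imx = imx *m X -> realmx (unreal X) = X.
Proof.
rewrite -(submxK X) /imx !mulmx_block.
rewrite !(mulmx0, mul0mx, mulmx1, mul1mx, addr0, add0r).
rewrite !(mulmxN, mulNmx, mulmx1, mul1mx) => /eq_block_mx[-> _ -> _].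
by rewrite /realmx /unreal block_mxKul block_mxKdl.
Qed.

Lemma realmxN x : realmx (- x) = - realmx x.
Proof. by rewrite /realmx /= opp_block_mx. Qed.

Lemma realmxZ a x : realmx (a *: x) = a *: realmx x.
Proof. by rewrite /realmx /= scale_block_mx scalerN. Qed.

Lemma realmxD x y : realmx (x + y) = realmx x + realmx y.
Proof. by rewrite /realmx add_block_mx /= opprD. Qed.

(** Realification doubles the real part of a trace, so the factor 1/2 in [dot] becomes 1/4. *)
Lemma dot_realmx x y : dot x y = \tr ((realmx x)^T *m realmx y) / 4.
Proof.
have -> : dot x y = (\tr (x.1^T *m y.1) + \tr (x.2^T *m y.2)) / 2.
  rewrite /dot; congr (_ / _).
  rewrite /mxtrace raddf_sum -big_split /=; apply: eq_bigr => i _.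
  rewrite !mxE raddf_sum -big_split /=; apply: eq_bigr => j _.
  by rewrite !mxE /= mulNr opprK.
rewrite /realmx tr_block_mx mulmx_block mxtrace_block !linearN/=.
rewrite mulNmx opprK !mxtraceD (addrC (\tr (x.2^T *m _))).
by field.
Qed.

End Realification.

Arguments imx {R m}.
Arguments unrealK {R m X}.

Section Stages.
Context {R : realType} {N : nat} (S : set 'M[R]_N) (J : nat -> 'M[R]_N).
Hypothesis S_tr : forall s, S s -> s^T = s \/ s^T = - s.
Implicit Types X Y Z : 'M[R]_N.

Definition commutes X := forall s, S s -> X *m s = s *m X.

(* With [S] encoding membership in U or Sp, the set of which the [k]-th term of
   the Bott chain is a component. *)
Definition stage k : set 'M[R]_N :=
  [set X | [/\ X *m X^T = 1%:M, commutes X, (0 < k)%N -> X *m X = - 1%:M &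
    forall i, (0 < i < k)%N -> X *m J i = - (J i *m X)]].

Lemma commutes_tr X : commutes X -> commutes X^T.
Proof.
move=> Xs s Ss; have := congr1 trmx (Xs s Ss); rewrite !trmx_mul.
by have [->|->] := S_tr Ss => [->//|]; rewrite mulNmx mulmxN => /oppr_inj ->.
Qed.

Lemma commutes_mul X Y : commutes X -> commutes Y -> commutes (X *m Y).
Proof. by move=> Xs Ys s Ss; rewrite -mulmxA Ys// mulmxA Xs// mulmxA. Qed.

Lemma commutesD X Y : commutes X -> commutes Y -> commutes (X + Y).
Proof. by move=> Xs Ys s Ss; rewrite mulmxDl mulmxDr Xs// Ys. Qed.

Lemma commutesZ a X : commutes X -> commutes (a *: X).
Proof. by move=> Xs s Ss; rewrite -scalemxAl -scalemxAr Xs. Qed.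

Lemma stage_tr_mul k X : stage k X -> X^T *m X = 1%:M.
Proof. by case=> /mulmx1C. Qed.

Lemma stage_skew k X : (0 < k)%N -> stage k X -> X^T = - X.
Proof.
move=> k0 [XX _ /(_ k0) X2 _].
by rewrite -[X^T]mul1mx -[1%:M]opprK -X2 mulNmx -mulmxA XX mulmx1.
Qed.

Lemma stageS k : stage k.+1 `<=` stage k.
Proof.
move=> X [XX XS X2 XJ]; split => // [_|i /andP[i0 ik]]; first exact: X2.
by apply: XJ; rewrite i0 ltnS ltnW.
Qed.

(** The tangent space of the stage at [X], translated to the identity: tangent vectors are the
    [X *m Z]. *)
Definition stage_dir k X Z := [/\ Z^T = - Z, commutes Z,
  (0 < k)%N -> Z *m X = - (X *m Z) &
  forall i, (0 < i < k)%N -> Z *m J i = J i *m Z].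

(** For [k > 0], moving [X] past [cayley Z s] inverts it, so the square remains - 1. *)
Lemma stage_cayley k X Z s : stage k X -> stage_dir k X Z ->
  stage k (X *m cayley Z s).
Proof.
move=> [XX XS X2 XJ] [Zs ZS ZX ZJ]; split.
- by rewrite trmx_mul -mulmxA (mulmxA (cayley Z s)) cayley_orth// mul1mx.
- apply: commutes_mul => // t St; exact/cayley_commute/ZS.
- move=> k0; rewrite -mulmxA (mulmxA (cayley Z s)) cayley_anticommute ?ZX//.
  rewrite -(mulmxA X _ (cayley Z s)) mulmxA X2//.
  by have := cayleyN (- s) Zs; rewrite opprK => ->; rewrite mulmx1.
- move=> i ik; rewrite -mulmxA cayley_commute ?ZJ// mulmxA XJ// mulNmx.
  by rewrite mulmxA.
Qed.

(** The last hypothesis says that [X Y^-1] is skew; it cancels the cross terms in the orthogonality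
    relation and in the square. *)
Lemma stage_circle k X Y a b : a ^+ 2 + b ^+ 2 = 1 ->
  stage k X -> stage k Y -> X *m Y^T + Y *m X^T = 0 ->
  stage k (a *: X + b *: Y).
Proof.
move=> ab sX sY XY; have [XX XS X2 XJ] := sX; have [YY YS Y2 YJ] := sY.
split.
- rewrite linearD !linearZ/= mulmxDl !mulmxDr -!scalemxAl -!scalemxAr !scalerA.
  rewrite XX YY.
  have -> : Y *m X^T = - (X *m Y^T) by apply/eqP; rewrite -addr_eq0 addrC XY.
  by rewrite scalerN (mulrC b a) addrA addrK -scalerDl -!expr2 ab scale1r.
- exact: commutesD (commutesZ a XS) (commutesZ b YS).
- move=> k0; rewrite mulmxDl !mulmxDr -!scalemxAl -!scalemxAr !scalerA.
  have -> : Y *m X = - (X *m Y).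
    move: XY; rewrite (stage_skew k0 sX) (stage_skew k0 sY) !mulmxN.
    by rewrite -opprD => /eqP; rewrite oppr_eq0 addr_eq0 => /eqP ->; rewrite opprK.
  rewrite X2// Y2// (scalerN (b * a)) (mulrC b a) addrA addrK -scalerDl -!expr2 ab.
  by rewrite scale1r.
- move=> i ik; rewrite mulmxDl mulmxDr -!scalemxAl -!scalemxAr XJ// YJ//.
  by rewrite !scalerN opprD.
Qed.

End Stages.

Section GeodesicsOfStages.
Context {R : realType} {N : nat} (S : set 'M[R]_N) (J : nat -> 'M[R]_N).
Hypothesis S_tr : forall s, S s -> s^T = s \/ s^T = - s.

Variables (k : nat) (g g1 g2 : R -> 'M[R]_N).
Hypothesis g_stage : forall t, stage S J k (g t).
Hypothesis J_skew : forall i, (0 < i < k)%N -> (J i)^T = - J i.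
Hypothesis gd : forall t : R, is_derive t 1 g (g1 t).
Hypothesis g1d : forall t : R, is_derive t 1 g1 (g2 t).

(* The derivative of [g^-1 g'].  As [g *m Y] is tangent, it is orthogonal to
   [g''], and this forces [Y = 0] along a geodesic. *)
Let Y t := (g1 t)^T *m g1 t + (g t)^T *m g2 t.

Let g_com t : commutes S (g t). Proof. by have [] := g_stage t. Qed.

Let g1_com t : commutes S (g1 t).
Proof.
move=> s Ss; apply: (@eq_is_derive _ _ (fun x => g x *m s) (fun x => s *m g x) t).
- by move=> x; rewrite g_com.
- exact: is_derive_mulmxr.
- exact: is_derive_mulmxl.
Qed.

Let g2_com t : commutes S (g2 t).
Proof.
move=> s Ss; apply: (@eq_is_derive _ _ (fun x => g1 x *m s) (fun x => s *m g1 x) t).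
- by move=> x; rewrite g1_com.
- exact: is_derive_mulmxr.
- exact: is_derive_mulmxl.
Qed.

Let g_J i t : (0 < i < k)%N -> g t *m J i = - (J i *m g t).
Proof. by move=> ik; have [_ _ _ ->] := g_stage t. Qed.

Let g1_J i t : (0 < i < k)%N -> g1 t *m J i = - J i *m g1 t.
Proof.
move=> ik; apply: (@eq_is_derive _ _ (fun x => g x *m J i) (fun x => - J i *m g x) t).
- by move=> x; rewrite g_J// mulNmx.
- exact: is_derive_mulmxr.
- exact: is_derive_mulmxl.
Qed.

Let g2_J i t : (0 < i < k)%N -> g2 t *m J i = - J i *m g2 t.
Proof.
move=> ik.
apply: (@eq_is_derive _ _ (fun x => g1 x *m J i) (fun x => - J i *m g1 x) t).
- by move=> x; rewrite g1_J.
- exact: is_derive_mulmxr.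
- exact: is_derive_mulmxl.
Qed.

Let tr_J i X : (0 < i < k)%N -> X *m J i = - J i *m X ->
  X^T *m J i = - J i *m X^T.
Proof.
move=> ik /(congr1 trmx); rewrite !trmx_mul linearN/= J_skew// opprK => <-//.
Qed.

Let X_der (t : R) : is_derive t 1 (fun x => (g x)^T *m g1 x) (Y t).
Proof. by apply: is_derive_mulmx => //; exact: is_derive_trmx. Qed.

Let X_skew (t : R) : ((g t)^T *m g1 t)^T = - ((g t)^T *m g1 t).
Proof.
have : is_derive t 1 (fun x => (g x)^T *m g x)
    ((g1 t)^T *m g t + (g t)^T *m g1 t).
  by apply: is_derive_mulmx => //; exact: is_derive_trmx.
have -> : (fun x => (g x)^T *m g x) = cst 1%:M.
  by apply/funext => x; exact: stage_tr_mul (g_stage x).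
move=> /is_derive_unique /(_ (is_derive_cst _ _ _)) /eqP.
by rewrite addr_eq0 trmx_mul trmxK => /eqP.
Qed.

(** Needed to test the geodesic equation against [g *m Y]. The conditions come from differentiating
    the relations of the stage twice. *)
Let Y_dir t : stage_dir S J k (g t) (Y t).
Proof.
split.
- apply: (@eq_is_derive _ _ (fun x => ((g x)^T *m g1 x)^T)
      (fun x => - ((g x)^T *m g1 x)) t); first exact: X_skew.
    exact: is_derive_trmx.
  exact: is_deriveN.
- by apply: commutesD; apply: commutes_mul => //; exact: commutes_tr.
- move=> k0.
  have gT x : (g x)^T = - 1 *: g x by rewrite scaleN1r (stage_skew k0 (g_stage x)).
  have gZ (f : R -> 'M[R]_N) (x : R) df : is_derive x 1 f df ->
      is_derive x 1 (fun y => -1 *: f y) (-1 *: df).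
    exact: is_deriveZ.
  have g1T : (g1 t)^T = - g1 t.
    rewrite -scaleN1r; apply: (eq_is_derive gT); first exact: is_derive_trmx.
    exact: gZ.
  have e1 x : g1 x *m g x + g x *m g1 x = 0.
    apply: (@eq_is_derive _ _ (fun x => g x *m g x) (cst (- 1%:M)) x).
    - by move=> y; have [_ _ ->] := g_stage y.
    - exact: is_derive_mulmx.
  have e2 : (g2 t *m g t + g1 t *m g1 t) + (g1 t *m g1 t + g t *m g2 t) = 0.
    apply: (@eq_is_derive _ _ (fun x => g1 x *m g x + g x *m g1 x) (cst 0) t) => //.
    by apply: is_deriveD; exact: is_derive_mulmx.
  have {}e1 : g1 t *m g t = - (g t *m g1 t).
    by apply/eqP; rewrite -addr_eq0 e1.
  have gg : g t *m g t = - 1%:M by have [_ _ ->] := g_stage t.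
  have XXa : g1 t *m g1 t *m g t = g t *m (g1 t *m g1 t).
    by rewrite -mulmxA e1 mulmxN (mulmxA _ (g t)) e1 mulNmx opprK mulmxA.
  (* This is [e2] multiplied by [g t] on the left, simplified by [g t *m g t = - 1]. *)
  have aZa : g t *m g2 t *m g t =
      g2 t - (g t *m (g1 t *m g1 t) + g t *m (g1 t *m g1 t)).
    have := congr1 (mulmx (g t)) e2.
    rewrite mulmx0 2!mulmxDr [g t *m (_ + g t *m _)]mulmxDr (mulmxA _ _ (g2 t)).
    rewrite gg mulNmx mul1mx mulmxA addrA => /eqP.
    by rewrite subr_eq0 -addrA eq_sym -subr_eq => /eqP <-.
  rewrite /Y g1T gT scaleN1r !mulNmx -opprD mulNmx mulmxN mulmxDl opprK XXa aZa.
  rewrite mulmxDr (mulmxA _ _ (g2 t)) gg mulNmx mul1mx [LHS]opprD.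
  by rewrite opprB addrA addrA [- _ + _]addNr add0r.
- move=> i ik; rewrite mulmxDl mulmxDr; congr (_ + _).
    rewrite -mulmxA g1_J// mulmxA mulmxN (tr_J ik (g1_J t ik)).
    by rewrite !mulNmx opprK mulmxA.
  rewrite -mulmxA g2_J// mulmxA mulmxN (tr_J ik) ?mulNmx ?opprK ?mulmxA//.
  by rewrite g_J// mulNmx.
Qed.

Hypothesis g_geodesic : forall t Z, stage_dir S J k (g t) Z ->
  \tr ((g2 t)^T *m (g t *m Z)) = 0.

(** In the pairing of [g2] with [g *m Y], the symmetric part [g1^T g1] is trace-orthogonal to the
    skew [Y], which leaves [tr (Y^T Y) = 0]. *)
Let Y_eq0 t : Y t = 0.
Proof.
have [Ys _ _ _] := Y_dir t.
have := g_geodesic (Y_dir t); rewrite mulmxA.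
have -> : (g2 t)^T *m g t = (Y t)^T - (g1 t)^T *m g1 t.
  by rewrite /Y linearD/= !trmx_mul !trmxK addrAC subrr add0r.
have sym : ((g1 t)^T *m g1 t)^T = (g1 t)^T *m g1 t by rewrite trmx_mul trmxK.
rewrite mulmxBl raddfB/= (sym_skew_trace sym Ys) subr0 => tr0.
by apply: oppr_inj; rewrite -Ys oppr0; apply: trace_mulmx_tr_eq0; rewrite trmxK.
Qed.

Let g1E t : g1 t = g t *m ((g 0)^T *m g1 0).
Proof.
have -> : (g 0)^T *m g1 0 = (g t)^T *m g1 t.
  apply: (@is_derive_0_mx_cst _ _ _ (fun t => (g t)^T *m g1 t)) => x.
  by rewrite -(Y_eq0 x).
by rewrite mulmxA; have [-> _ _ _] := g_stage t; rewrite mul1mx.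
Qed.

(** With [g^-1 g' = Z] constant, [g] would be [g(0) exp (t Z)]; this is the resulting invariance,
    obtained without the exponential. *)
Lemma geodesic_translation a s t : g (s + a) *m (g s)^T = g (t + a) *m (g t)^T.
Proof.
apply: (@is_derive_0_mx_cst _ _ _ (fun t => g (t + a) *m (g t)^T)) => {s}t.
have := is_derive_mulmx (is_derive_translate (a := a) (gd (t + a)))
  (is_derive_trmx (gd t)).
congr (is_derive _ _ _ _); rewrite (g1E (t + a)) (g1E t) [X in _ + _ *m X]trmx_mul.
by rewrite X_skew mulNmx mulmxN -!mulmxA subrr.
Qed.

Lemma geodesic_midpoint_mx : g 1 = g 2^-1 *m (g 0)^T *m g 2^-1.
Proof.
have := geodesic_translation 2^-1 2^-1 0.
rewrite add0r (_ : 2^-1 + 2^-1 = 1 :> R); last by field.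
by move=> <-; rewrite -mulmxA (stage_tr_mul (g_stage _)) mulmx1.
Qed.

End GeodesicsOfStages.

(** Expresses that [M] is a union of connected components of [A]. *)
Definition saturated {T : topologicalType} (M A : set T) :=
  M `<=` A /\
  forall B, connected B -> B `<=` A -> M `&` B !=set0 -> B `<=` M.

Lemma saturated_connected {T : topologicalType} (M A : set T) :
  saturated M A -> connected A -> M !=set0 -> M = A.
Proof.
move=> [MA sat] cA [x Mx]; apply/seteqP; split => //; apply: sat => //.
by exists x; split => //; exact: MA.
Qed.

Section Circle.
Context {R : realType} {V : normedModType R} (o x : V).

Definition circle (t : R) : V := cos (pi * t) *: o + sin (pi * t) *: x.

(** Arbitrary coefficients let one formula differentiate both [circle] and its derivative, in which
    [o] and [x] trade places. *)
Lemma is_derive_circle (a b t : R) (u v : V) :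
  is_derive t 1 (fun t : R => (a * cos (pi * t)) *: u + (b * sin (pi * t)) *: v)
    ((- (a * pi) * sin (pi * t)) *: u + (b * pi * cos (pi * t)) *: v).
Proof.
have pd : is_derive t 1 (fun t : R => pi * t) pi.
  have := @is_deriveZ _ _ _ id (pi : R) t 1 _ (is_derive_id t 1).
  by rewrite [X in is_derive _ _ _ X]mulr1.
apply: is_deriveD.
- apply: is_derive_scalel.
  have := @is_deriveZ _ _ _ (cos \o (fun t : R => pi * t)) a _ _ _
     (is_derive1_comp (is_derive_cos _) pd).
  by congr (is_derive _ _ _ _); rewrite /GRing.scale/=; ring.
- apply: is_derive_scalel.
  have := @is_deriveZ _ _ _ (sin \o (fun t : R => pi * t)) b _ _ _
     (is_derive1_comp (is_derive_sin _) pd).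
  by congr (is_derive _ _ _ _); rewrite /GRing.scale/=; ring.
Qed.

Lemma circleE : circle =
  fun t => (1 * cos (pi * t)) *: o + (1 * sin (pi * t)) *: x.
Proof. by apply/funext => t; rewrite !mul1r. Qed.

Lemma derive_circle (t : R) : is_derive t 1 circle
  ((- pi * sin (pi * t)) *: o + (pi * cos (pi * t)) *: x).
Proof. by rewrite circleE; have := is_derive_circle 1 1 t o x; rewrite !mul1r. Qed.

Lemma derive1_circle : derive1 circle =
  fun t => (pi * cos (pi * t)) *: x + (- pi * sin (pi * t)) *: o.
Proof.
by apply/funext => t; rewrite derive1E addrC; have [_ ->] := derive_circle t.
Qed.

Lemma derive2_circle (t : R) : is_derive t 1 (derive1 circle) (- pi ^+ 2 *: circle t).
Proof.
rewrite derive1_circle; have := is_derive_circle pi (- pi) t x o.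
congr (is_derive _ _ _ _); rewrite addrC scalerDr !scalerA.
by congr (_ *: _ + _ *: _); ring.
Qed.

Lemma circle_continuous : continuous circle.
Proof. by apply: derivable_curve_continuous => t; case: (derive_circle t). Qed.

Lemma circle0 : circle 0 = o.
Proof. by rewrite /circle mulr0 cos0 sin0 scale1r scale0r addr0. Qed.

Lemma circle1 : circle 1 = - o.
Proof. by rewrite /circle mulr1 cospi sinpi scaleN1r scale0r addr0. Qed.

Lemma circle_half : circle 2^-1 = x.
Proof. by rewrite /circle cos_pihalf sin_pihalf scale0r scale1r add0r. Qed.

End Circle.

Section Centrosomes.
Context {R : realType} {m : nat} (S : set 'M[R]_(m + m)) (J : nat -> cmat R m).
Hypothesis S_tr : forall s, S s -> s^T = s \/ s^T = - s.
Hypothesis S_imx : S imx.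
Let rJ k := realmx (J k).
Hypothesis J0 : rJ 0 = 1%:M.

Definition stage_set k : set (cmat R m) := realmx @^-1` stage S rJ k.

Lemma linear_curve_is_derive p (f : cmat R m -> 'M[R]_p) c (t : R) v :
  linear f -> is_derive t 1 c v -> is_derive t 1 (f \o c) (f v).
Proof.
by move=> fl; apply: linear_is_derive => //; exact: cmat_linear_continuous.
Qed.

(** The Cayley curve through [x] is connected and lies in the stage, so saturation keeps it in [M];
    its velocity at 0 accounts for [Z + Z]. *)
Lemma tangent_stage_dir k M x Z : saturated M (stage_set k) -> M x ->
  stage_dir S rJ k (realmx x) Z -> tangent M x (unreal (realmx x *m (Z + Z))).
Proof.
move=> [MA sat] Mx Zdir; have [Zs _ _ _] := Zdir.
have sx := MA _ Mx.
pose d s := unreal (realmx x *m cayley Z s).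
have dE s : realmx (d s) = realmx x *m cayley Z s.
  by apply: unrealK; have [_ + _ _] := stage_cayley s sx Zdir; apply.
have d0 : d 0 = x by rewrite /d cayley0 mulmx1 realmxK.
have dder (s : R) v : is_derive s 1 (cayley Z) v ->
    is_derive s 1 d (unreal (realmx x *m v)).
  move=> /(is_derive_mulmxl (realmx x)).
  exact: (linear_is_derive unreal_linear unreal_continuous).
exists d; split => //; last exact/dder/cayley_is_derive0.
suff : range d `<=` M by move=> dM t; apply: dM; exists t.
apply: sat; first 1 last.
- by move=> _ [s _ <-]; rewrite /stage_set /= dE; exact: stage_cayley.
- by exists x; split => //; exists 0.
apply: connected_range; apply: derivable_curve_continuous => s.
by have [] := dder _ _ (derivableP (cayley_derivable (s := s) Zs)).
Qed.

(** Orthogonal matrices lie on a sphere for the trace form, so the position vector is normal to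
    [M]. *)
Lemma tangent_orth k M x v : M `<=` stage_set k -> tangent M x v ->
  \tr ((realmx x)^T *m realmx v) = 0.
Proof.
move=> MA [c [Mc <-]] /(linear_curve_is_derive realmx_linear) cv.
have := is_derive_mulmx cv (is_derive_trmx cv).
have -> : (fun t => (realmx \o c) t *m ((realmx \o c) t)^T) = cst 1%:M.
  by apply/funext => t /=; have [-> _ _ _] := MA _ (Mc t).
move=> /is_derive_unique /(_ (is_derive_cst _ _ _)) /(congr1 mxtrace).
rewrite mxtraceD mxtrace0 -[\tr (realmx _ *m (realmx v)^T)]mxtrace_tr trmx_mul.
rewrite trmxK mxtrace_mulC -mulr2n => /eqP; rewrite mulrn_eq0 /= => /eqP.
by [].
Qed.

Lemma centrosome_saturated k M : saturated M (stage_set k) -> M (J k) ->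
  (forall i, (0 < i < k)%N -> (rJ i)^T = - rJ i) ->
  centrosome dot M (J k) (- J k) = M `&` stage_set k.+1.
Proof.
move=> Msat MJ Jskew; have [MA sat] := Msat; have sJ := MA _ MJ.
apply/seteqP; split=> x.
- move=> [c [[cM cd c1d cgeo] c0 c1] <-]; split; first exact: cM.
  rewrite /midpoint /stage_set /=; set y := realmx (c _).
  pose g t := realmx (c t); pose g1 t := realmx (derive1 c t).
  pose g2 t := realmx (derive1n 2 c t).
  have gs t : stage S rJ k (g t) by exact: MA.
  have gd (t : R) : is_derive t 1 g (g1 t).
    have ct : is_derive t 1 c (derive1 c t) by rewrite derive1E; exact: derivableP.
    exact: (linear_curve_is_derive realmx_linear ct).
  have g1d (t : R) : is_derive t 1 g1 (g2 t).
    have ct : is_derive t 1 (derive1 c) (derive1n 2 c t).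
      by rewrite derive1nS derive1n1 derive1E; exact: derivableP.
    exact: (linear_curve_is_derive realmx_linear ct).
  have ggeo t Z : stage_dir S rJ k (g t) Z -> \tr ((g2 t)^T *m (g t *m Z)) = 0.
    move=> Zdir; have [_ ZS _ _] := Zdir.
    have := cgeo t _ (tangent_stage_dir Msat (cM t) Zdir).
    rewrite dot_realmx unrealK; last first.
      apply: commutes_mul S_imx => //; first by have [] := gs t.
      exact: commutesD.
    move=> /eqP; rewrite mulf_eq0 invr_eq0 pnatr_eq0 orbF -/(g t) -/(g2 t).
    by rewrite !mulmxDr mxtraceD -mulr2n mulrn_eq0 /= => /eqP.
  have := geodesic_midpoint_mx S_tr gs Jskew gd g1d ggeo.
  rewrite /g c0 c1 -/y realmxN -/(rJ k) => yJy.
  have sy : stage S rJ k y by exact: gs.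
  have [yy yS y2 yJ] := sy; split => //.
    (* For [k = 0] the midpoint formula with [J 0 = 1] reads [y y = - 1]; for [k > 0] the relation
       is inherited from stage [k]. *)
    move=> _; have [k0|/y2//] := posnP k.
    by move: yJy; rewrite k0 J0 trmx1 mulmx1.
  move=> i /andP[i0]; rewrite ltnS leq_eqVlt => /orP[/eqP ik|ik]; last first.
    by apply: yJ; rewrite i0.
  (* The new relation: the midpoint formula becomes [J k = y J k y], to be multiplied by [y] on the
     right, where [y y = - 1]. *)
  rewrite ik in i0 *; move: yJy; rewrite (stage_skew i0 sJ) mulmxN mulNmx.
  move=> /oppr_inj => yJy; rewrite {2}yJy -!mulmxA y2// !mulmxN mulmx1.
  by rewrite opprK.
- move=> [Mx sx]; exists (circle (J k) x); last exact: circle_half.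
  have M_circ t : M (circle (J k) x t).
    suff : range (circle (J k) x) `<=` M by apply; exists t.
    apply: sat; first exact/connected_range/circle_continuous.
      move=> _ [s _ <-].
      have -> : stage_set k (circle (J k) x s) =
          stage S rJ k (cos (pi * s) *: rJ k + sin (pi * s) *: realmx x).
        by rewrite /stage_set /= /circle realmxD !realmxZ.
      apply: stage_circle => //; first exact: cos2Dsin2.
        exact: stageS.
      rewrite (stage_skew _ sx)//; have [_ _ _ xJ] := sx.
      have [k0|k0] := posnP k; first by rewrite k0 J0 trmx1 mulmx1 mul1mx addNr.
      by rewrite (stage_skew k0 sJ) !mulmxN xJ ?k0//= opprK addNr.
    by exists (J k); split => //; exists 0 => //; exact: circle0.
  split; [split => //|exact: circle0|exact: circle1].
  + by move=> t; have [] := derive_circle (J k) x t.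
  + by move=> t; have [] := derive2_circle (J k) x t.
  (* The acceleration is a multiple of the position vector, which is normal to [M]. *)
  + move=> t v /(tangent_orth MA) tv.
    have -> : derive1n 2 (circle (J k) x) t = - pi ^+ 2 *: circle (J k) x t.
      by rewrite derive1nS derive1n1 derive1E; have [_ ->] := derive2_circle (J k) x t.
    by rewrite dot_realmx realmxZ linearZ/= -scalemxAl linearZ/= tv mulr0 mul0r.
Qed.

(** A connected part of stage [k.+1] meeting [C] stays in [M] because stages decrease, hence in the
    centrosome, hence in its component [C]. *)
Lemma centriole_saturated k M C : saturated M (stage_set k) ->
  (forall i, (0 < i < k)%N -> (rJ i)^T = - rJ i) ->
  centriole dot M (J k) (- J k) C -> saturated C (stage_set k.+1) /\ C !=set0.
Proof.
move=> Msat Jskew [_ [x Ex <-]].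
have MJ : M (J k) by case: Ex => c [[cM _ _ _] <- _] _; exact: cM.
rewrite centrosome_saturated// in Ex *.
split; last by exists x; exact: connected_component_refl.
have [MA sat] := Msat; split=> [y /connected_component_sub[]//|B cB BA].
move=> [y [Cy By]]; have [My _] := connected_component_sub Cy.
rewrite (same_connected_component Cy); apply: connected_component_max => //.
move=> z Bz; split; last exact: BA.
apply: sat Bz => //; first by move=> w /BA; exact: stageS.
by exists y.
Qed.

Lemma chain_saturated (M : nat -> set (cmat R m)) n :
  M 0%N = stage_set 0 ->
  (forall i, (0 < i < n)%N -> (rJ i)^T = - rJ i) ->
  (forall k, (k < n)%N -> centriole dot (M k) (J k) (- J k) (M k.+1)) ->
  saturated (M n) (stage_set n) /\ ((0 < n)%N -> M n !=set0).
Proof.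
move=> M0 Jskew cen.
suff H k : (k <= n)%N -> saturated (M k) (stage_set k) /\ ((0 < k)%N -> M k !=set0).
  exact: H.
elim: k => [_|k IH kn].
  by rewrite M0; split => //; split => // B _ BA [x [_ Bx]].
have [IHs _] := IH (ltnW kn).
have [|] := centriole_saturated IHs _ (cen _ kn); last by [].
by move=> i /andP[i0 ik]; apply: Jskew; rewrite i0 (ltn_trans ik kn).
Qed.

End Centrosomes.

(** * Connectedness of U and Sp *)

Section Doubling.
Context {R : realType} {N : nat}.
Implicit Types K L X Y : 'M[R]_N.

(** For orthogonal [K] this is [X + K X K^-1]: it extends an operator on a subspace to the span of
    that subspace and its image under [K]. *)
Definition dbl K X := X + K *m X *m K^T.

Lemma dbl_tr K X : (dbl K X)^T = dbl K X^T.
Proof. by rewrite /dbl linearD/= !trmx_mul trmxK mulmxA. Qed.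

Lemma dbl_linear K : linear (dbl K).
Proof.
move=> a X Y; rewrite /dbl mulmxDr mulmxDl -scalemxAr -scalemxAl scalerDr.
by rewrite addrACA.
Qed.

Lemma dblN K X : dbl K (- X) = - dbl K X.
Proof. by rewrite /dbl mulmxN mulNmx opprD. Qed.

Lemma dbl_commute K X : K^T = - K -> K *m K = - 1%:M ->
  dbl K X *m K = K *m dbl K X.
Proof.
move=> Ks K2; rewrite /dbl Ks !mulmxN mulmxBl mulmxBr -mulmxA K2 mulmxN mulmx1.
by rewrite -(mulmxA K X K) (mulmxA K K) K2 mulNmx mul1mx !opprK addrC.
Qed.

Lemma dbl_commute_comm K L X : L *m K = K *m L -> K^T = - K ->
  X *m L = L *m X -> dbl K X *m L = L *m dbl K X.
Proof.
move=> LK Ks XL; rewrite /dbl mulmxDl mulmxDr XL Ks !mulmxN mulNmx; congr (_ - _).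
by rewrite -!mulmxA -LK (mulmxA X) XL !mulmxA LK.
Qed.

(** The signs from moving [L] past [K] and past [K^T] cancel. *)
Lemma dbl_commute_anti K L X : L *m K = - (K *m L) -> K^T = - K ->
  X *m L = L *m X -> dbl K X *m L = L *m dbl K X.
Proof.
move=> LK Ks XL; rewrite /dbl mulmxDl mulmxDr XL Ks !mulmxN mulNmx; congr (_ - _).
have KL : K *m L = - (L *m K) by rewrite LK opprK.
by rewrite -!mulmxA KL !mulmxN (mulmxA X) XL !mulmxA LK !mulNmx.
Qed.

(** The last hypothesis makes the cross terms vanish; it holds for operators on a subspace that [K]
    moves into its orthogonal complement. *)
Lemma dbl_mul K X Y : K^T = - K -> K *m K = - 1%:M -> X *m K *m Y = 0 ->
  dbl K X *m dbl K Y = dbl K (X *m Y).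
Proof.
move=> Ks K2 XKY; rewrite /dbl Ks !mulmxN mulmxBl !mulmxBr.
rewrite !mulmxA XKY mul0mx subr0 -(mulmxA K X K) -(mulmxA K (X *m K)) XKY.
rewrite mulmx0 sub0r opprK; congr (_ + _).
by rewrite -!mulmxA (mulmxA K K) K2 mulNmx mul1mx !mulmxN.
Qed.

Lemma dbl_mull K X Y : K^T = - K -> X *m K = K *m X ->
  dbl K (X *m Y) = X *m dbl K Y.
Proof. by move=> Ks XK; rewrite /dbl mulmxDr !mulmxA XK. Qed.

Lemma dbl_trace K X : K^T *m K = 1%:M -> \tr (dbl K X) = \tr X *+ 2.
Proof. by move=> KK; rewrite mxtraceD mxtrace_mulC mulmxA KK mul1mx. Qed.

End Doubling.

Section OrthogonalCommutant.
Context {R : realType} {N : nat} (I J D : 'M[R]_N) (b : bool).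
Hypotheses (I_tr : I^T = - I) (I2 : I *m I = - 1%:M).
Hypotheses (J_tr : J^T = - J) (J2 : J *m J = - 1%:M).
Hypotheses (D_tr : D^T = D) (D2 : D *m D = 1%:M).
Hypotheses (IJ : I *m J = - (J *m I)).
Hypotheses (DI : D *m I = I *m D) (DJ : D *m J = - (J *m D)).
Implicit Types (X Y P Q : 'M[R]_N) (e : 'rV[R]_N).

(** The flag [b] selects U ([true]) or Sp ([false]), so that one argument covers both. *)
Definition structure : set 'M[R]_N :=
  [set s | [\/ s = I, s = J | b /\ s = D]].

Definition orth_commutant : set 'M[R]_N :=
  [set X | X *m X^T = 1%:M /\ commutes structure X].

Local Notation G := orth_commutant.

Lemma structure_tr s : structure s -> s^T = s \/ s^T = - s.
Proof. by move=> [->|->|[_ ->]]; [right|right|left]. Qed.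

Lemma commutesP X : X *m I = I *m X -> X *m J = J *m X ->
  (b -> X *m D = D *m X) -> commutes structure X.
Proof. by move=> XI XJ XD s [->|->|[/XD + ->]]. Qed.

Lemma orth_commutant_mul X Y : G X -> G Y -> G (X *m Y).
Proof.
move=> [XX XS] [YY YS]; split; last exact: commutes_mul.
by rewrite trmx_mul -mulmxA (mulmxA Y) YY mul1mx.
Qed.

(* If [- 1] is not an eigenvalue of [X], then [X = cayley Y 1] for a [Y] that
   commutes with whatever [X] commutes with. *)
Lemma cayley_component X : G X -> 1%:M + X \in unitmx ->
  connected_component G 1%:M X.
Proof.
move=> [XX XS] U; have XX' := mulmx1C XX.
pose Y := (X - 1%:M) *m invmx (1%:M + X).
have com Z : Z *m X = X *m Z -> Y *m Z = Z *m Y.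
  move=> ZX; have e : (1%:M + X) *m Z = Z *m (1%:M + X).
    by rewrite mulmxDl mulmxDr mul1mx mulmx1 ZX.
  have {}e : invmx (1%:M + X) *m Z = Z *m invmx (1%:M + X).
    apply: (can_inj (mulKmx U)); rewrite mulmxA mulmxV// mul1mx mulmxA e.
    by rewrite -mulmxA mulmxV// mulmx1.
  rewrite /Y -mulmxA e mulmxA [RHS]mulmxA; congr (_ *m _).
  by rewrite mulmxBl mulmxBr mul1mx mulmx1 ZX.
have YU : Y *m (1%:M + X) = X - 1%:M by rewrite /Y -mulmxA mulVmx// mulmx1.
have UT : (1%:M + X)^T \in unitmx by rewrite unitmx_tr.
(* Multiplied by [(1 + X)^T] on the left and [1 + X] on the right, this becomes
   [X^T - X = - (X - X^T)]. *)
have Ys : Y^T = - Y.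
  have e1 : (X - 1%:M)^T *m (1%:M + X) = X^T - X.
    by rewrite mulmxDr mulmx1 linearB/= trmx1 mulmxBl XX' mul1mx addrA subrK.
  have e2 : (1%:M + X)^T *m (X - 1%:M) = X - X^T.
    rewrite mulmxBr mulmx1 linearD/= trmx1 mulmxDl mul1mx XX' opprD addrA.
    by rewrite addrK.
  apply: (can_inj (mulKmx UT)); apply: (can_inj (mulmxK U)).
  by rewrite -trmx_mul YU e1 mulmxN mulNmx -mulmxA YU e2 opprB.
have XE : X = cayley Y 1.
  apply: cayley_uniq => //; rewrite scale1r mulmxBl mul1mx.
  have -> : Y *m X = X - 1%:M - Y by rewrite -YU mulmxDr mulmx1 addrAC subrr add0r.
  by rewrite -addrA opprD addrA subrr add0r opprD !opprK.
apply: (@connected_component_max _ _ (range (cayley Y))).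
- by exists 0 => //; exact: cayley0.
- move=> _ [s _ <-]; split; first exact: cayley_orth.
  by move=> t St; apply: cayley_commute => //; apply: com; rewrite XS.
- apply: connected_range; apply: derivable_curve_continuous => s.
  exact: cayley_derivable.
- by exists 1.
Qed.

(** [A] is an orthogonal transformation of the range of the projection [P]; adding [1 - P] extends
    it by the identity. *)
Lemma rotation_orth P A : P *m P = P -> P^T = P -> P *m A^T = A^T ->
  A *m P = A -> A *m A^T = P -> (1%:M - P + A) *m (1%:M - P + A)^T = 1%:M.
Proof.
move=> PP PT PA AP AA.
have -> : (1%:M - P + A)^T = 1%:M - P + A^T.
  by rewrite 2!linearD/= linearN/= trmx1 PT.
rewrite mulmxDl [(1%:M - P) *m _]mulmxDr [A *m (_ + A^T)]mulmxDr AA.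
rewrite mulmxBr mulmx1 mulmxBl mul1mx PP subrr subr0.
by rewrite mulmxBl mul1mx PA subrr addr0 mulmxBr mulmx1 AP subrr add0r subrK.
Qed.

(* [Q] projects onto a complex line [L] with [L J] orthogonal to [L]; the
   rotation by [t] of the quaternionic line [L + L J] ends at [- 1] on it. *)
Lemma rotation_component X Q : G X -> Q^T = Q -> Q *m Q = Q ->
  Q *m I = I *m Q -> Q *m J *m Q = 0 -> (b -> Q *m D = D *m Q) ->
  connected_component G X (X *m (1%:M - (dbl J Q + dbl J Q))).
Proof.
move=> GX QT QQ QI QJQ QD.
(* [P] projects onto the quaternionic line, and [T] is a skew complex structure on it commuting with
   all the structures, so [cos t P + sin t T] rotates inside the commutant. *)
pose P := dbl J Q; pose T := dbl J (Q *m I).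
have PP : P *m P = P by rewrite /P dbl_mul// QQ.
have PT : P^T = P by rewrite /P dbl_tr QT.
have TT : T^T = - T.
  rewrite /T dbl_tr trmx_mul QT I_tr mulNmx -QI.
  by rewrite /dbl mulmxN mulNmx opprD.
have IQJQ : I *m (Q *m J *m Q) = 0 by rewrite QJQ mulmx0.
have TP : T *m P = T.
  rewrite /T /P dbl_mul//; first by rewrite -mulmxA -QI mulmxA QQ.
  by rewrite QI -!mulmxA (mulmxA Q).
have PTe : P *m T = T.
  by apply: trmx_inj; rewrite trmx_mul PT TT mulNmx TP.
have T2 : T *m T = - P.
  rewrite /T /P dbl_mul//.
    by rewrite QI -mulmxA (mulmxA Q) QI -(mulmxA I Q) QQ mulmxA I2 mulNmx mul1mx
      /dbl mulmxN mulNmx opprD.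
  by rewrite {1}QI -!mulmxA (mulmxA J) (mulmxA Q) [Q *m (J *m Q)]mulmxA QJQ
    mul0mx mulmx0.
have com L : (L *m J = J *m L \/ L *m J = - (J *m L)) -> Q *m L = L *m Q ->
    I *m L = L *m I -> P *m L = L *m P /\ T *m L = L *m T.
  have H Z : (L *m J = J *m L \/ L *m J = - (J *m L)) -> Z *m L = L *m Z ->
      dbl J Z *m L = L *m dbl J Z.
    by move=> [LJ|LJ] ZL; [exact: dbl_commute_comm|exact: dbl_commute_anti].
  move=> LJ QL IL; split; apply: H => //.
  by rewrite -mulmxA IL mulmxA QL mulmxA.
have GR (t : R) : G (1%:M - P + (cos t *: P + sin t *: T)).
  set A := cos t *: P + sin t *: T; pose A' := cos t *: P - sin t *: T.
  have AT : A^T = A' by rewrite /A linearD/= !linearZ/= PT TT scalerN.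
  have PA' : P *m A' = A'.
    by rewrite /A' mulmxBr -!scalemxAr PP PTe.
  have AP : A *m P = A by rewrite /A mulmxDl -!scalemxAl PP TP.
  have AA' : A *m A' = P.
    rewrite /A /A' mulmxDl !mulmxBr -!scalemxAl -!scalemxAr PP PTe TP T2.
    rewrite !scalerA [sin t * cos t]mulrC !scalerN opprK addrA subrK -scalerDl.
    by rewrite -!expr2 cos2Dsin2 scale1r.
  split; first by apply: rotation_orth; rewrite ?AT.
  have comR L : P *m L = L *m P /\ T *m L = L *m T ->
      (1%:M - P + A) *m L = L *m (1%:M - P + A).
    move=> [PL TL]; have AL : A *m L = L *m A.
      by rewrite /A mulmxDl mulmxDr -!scalemxAl -!scalemxAr PL TL.
    by rewrite mulmxDl mulmxDr AL mulmxBl mulmxBr mul1mx mulmx1 PL.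
  apply: commutesP; [apply/comR|apply/comR|move=> bb; apply/comR].
  - exact: (com I (or_intror IJ) QI erefl).
  - by split; exact: dbl_commute.
  - exact: (com D (or_intror DJ) (QD bb) (esym DI)).
apply: (@connected_component_max _ _
  (range (fun t => X *m (1%:M - P + (cos t *: P + sin t *: T))))).
- exists 0 => //; rewrite cos0 sin0 scale1r scale0r addr0.
  by rewrite subrK mulmx1.
- by move=> _ [t _ <-]; exact: orth_commutant_mul.
- apply: connected_range.
  pose h (t : R) : 'M[R]_N := cos t *: P + sin t *: T.
  have hc : continuous h.
    apply: derivable_curve_continuous => t.
    have := is_deriveD (is_derive_scalel P (is_derive_cos t))
      (is_derive_scalel T (is_derive_sin t)).
    by case.
  have lc : continuous (fun Y : 'M[R]_N => X *m Y).
    by apply: mx_linear_continuous => a Y Z; rewrite mulmxDr -scalemxAr.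
  move=> t; apply: (@continuous_comp _ _ _ (fun t => 1%:M - P + h t)).
    by apply: cvgD; [exact: cvg_cst|exact: hc].
  exact: lc.
- exists pi => //; rewrite cospi sinpi scale0r addr0 scaleN1r -addrA.
  by rewrite -opprD.
Qed.

Lemma skew_sandwich e Z : Z^T = - Z -> e^T *m e *m Z *m (e^T *m e) = 0.
Proof.
move=> Zs; rewrite -!mulmxA (mulmxA e Z) (mulmxA (e *m Z)).
by rewrite skew_quadratic_form// mul0mx mulmx0.
Qed.

(** By [I J I = J], each of the four terms of the expansion contains [P J P] or, up to sign,
    [P I J P]. *)
Lemma dbl_sandwich P : P *m J *m P = 0 -> P *m (I *m J) *m P = 0 ->
  dbl I P *m J *m dbl I P = 0.
Proof.
move=> PJP PIJP; have PJIP : P *m (J *m I) *m P = 0.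
  by move: PIJP; rewrite IJ mulmxN mulNmx => /eqP; rewrite oppr_eq0 => /eqP.
have IJI : I *m J *m I = J by rewrite IJ mulNmx -mulmxA I2 mulmxN mulmx1 opprK.
have -> : dbl I P = P - I *m P *m I by rewrite /dbl I_tr mulmxN.
rewrite !mulmxBl !mulmxBr PJP.
have -> : P *m J *m (I *m P *m I) = P *m (J *m I) *m P *m I by rewrite !mulmxA.
have -> : I *m P *m I *m J *m P = I *m (P *m (I *m J) *m P) by rewrite !mulmxA.
have -> : I *m P *m I *m J *m (I *m P *m I) = I *m (P *m (I *m J *m I) *m P) *m I.
  by rewrite !mulmxA.
by rewrite IJI PJP PJIP PIJP !(mulmx0, mul0mx) !subr0.
Qed.

(** [Q] projects onto the complex line spanned by [e] and [e I]. Since [J] and [I J] are skew, [J]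
    moves it to an orthogonal line; an eigenvector [e] of [D] makes it stable under [D]. *)
Lemma quaternion_line_proj e : e *m e^T = 1%:M ->
    (b -> exists2 s : R, s * s = 1 & e *m D = s *: e) ->
  exists Q, [/\ Q^T = Q, Q *m Q = Q, Q *m I = I *m Q, Q *m J *m Q = 0 &
    b -> Q *m D = D *m Q] /\ e *m dbl J Q = e /\
    (forall X, X *m e^T = - e^T -> commutes structure X ->
       X *m dbl J Q = - dbl J Q).
Proof.
move=> ee eD; pose P := e^T *m e; exists (dbl I P).
have PT : P^T = P by rewrite /P trmx_mul trmxK.
have PP : P *m P = P by rewrite /P -mulmxA (mulmxA e) ee mul1mx.
have JI_tr : (J *m I)^T = - (J *m I).
  by rewrite trmx_mul I_tr J_tr mulNmx mulmxN opprK IJ.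
have IJ_tr : (I *m J)^T = - (I *m J).
  by rewrite trmx_mul I_tr J_tr mulNmx mulmxN opprK IJ opprK.
have eS Z : Z^T = - Z -> e *m Z *m P = 0.
  by move=> Zs; rewrite /P mulmxA skew_quadratic_form// mul0mx.
have eQ : e *m dbl I P = e.
  by rewrite mulmxDr !mulmxA ee mul1mx skew_quadratic_form// !mul0mx addr0.
split; first split.
- by rewrite dbl_tr PT.
- by rewrite dbl_mul ?PP// /P skew_sandwich.
- exact: dbl_commute.
- by apply: dbl_sandwich; rewrite /P skew_sandwich.
- move=> bb; have [s ss eDs] := eD bb; apply: dbl_commute_comm => //.
  rewrite /P -mulmxA eDs mulmxA.
  have -> : D *m e^T = s *: e^T by rewrite -{1}D_tr -trmx_mul eDs linearZ.
  by rewrite -scalemxAl -scalemxAr.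
split.
  rewrite {1}/dbl mulmxDr eQ (_ : e *m (J *m _ *m _) = 0) ?addr0//.
  have -> : e *m (J *m dbl I P *m J^T) = (e *m J *m P +
      e *m (J *m I) *m P *m I^T) *m J^T.
    by rewrite !mulmxA; congr (_ *m _); rewrite mulmxDr !mulmxA.
  by rewrite !eS// !mul0mx addr0 mul0mx.
move=> X Xe XS.
have XI : X *m I = I *m X by apply: XS; constructor 1.
have XJ : X *m J = J *m X by apply: XS; constructor 2.
rewrite -dbl_mull// -dbl_mull// mulmxA Xe mulNmx -/P.
by rewrite !dblN.
Qed.

(* Rotating a quaternionic line on which [X = - 1] makes [X = 1] there, which
   lowers the dimension of the kernel of [1 + X]. *)
Lemma orth_commutant_component X : G X -> connected_component G 1%:M X.
Proof.
have [k] := ubnP (\rank (kermx (1%:M + X))).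
elim: k X => // k IH X rk GX; have [XX XS] := GX.
have [U|nU] := boolP (1%:M + X \in unitmx); first exact: cayley_component.
have [v [v0 vX vD]] : exists v : 'rV[R]_N, [/\ v != 0, v *m (1%:M + X) = 0 &
    b -> exists2 s : R, s * s = 1 & v *m D = s *: v].
  have /rowV0Pn[v /sub_kermxP vX v0] : kermx (1%:M + X) != 0.
    by rewrite kermx_eq0 row_free_unit.
  have [bb|nb] := boolP b; last by exists v; split => // bb; rewrite bb in nb.
  (* The kernel of [1 + X] is stable under [D], so it contains an eigenvector: [v] itself for - 1,
     or else [v + v D] for 1. *)
  have [vD0|vDn0] := eqVneq (v + v *m D) 0.
    exists v; split=> // _; exists (-1); first by rewrite mulrNN mulr1.
    by rewrite scaleN1r; apply/eqP; rewrite -addr_eq0 addrC vD0.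
  exists (v + v *m D); split=> // [|_].
    have XD : X *m D = D *m X by apply: XS; constructor 3.
    rewrite mulmxDl vX add0r -mulmxA.
    have -> : D *m (1%:M + X) = (1%:M + X) *m D.
      by rewrite mulmxDl mulmxDr mul1mx mulmx1 XD.
    by rewrite mulmxA vX mul0mx.
  exists 1; first by rewrite mulr1.
  by rewrite scale1r mulmxDl -mulmxA D2 mulmx1 addrC.
have [a a0 ee] := row_normalize v0.
set e := a *: v in ee.
have eX : e *m (1%:M + X) = 0 by rewrite /e -scalemxAl vX scaler0.
have eD : b -> exists2 s : R, s * s = 1 & e *m D = s *: e.
  move=> /vD[s ss vDs]; exists s => //.
  by rewrite /e -scalemxAl vDs !scalerA mulrC.
have [Q [[QT QQ QI QJQ QD] [eP XP]]] := quaternion_line_proj ee eD.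
have Xe : X *m e^T = - e^T.
  move: eX; rewrite mulmxDr mulmx1 => /eqP; rewrite addr_eq0 => /eqP eX.
  have eT : e^T = - (X^T *m e^T) by rewrite {1}eX linearN/= trmx_mul.
  by rewrite [in LHS]eT mulmxN mulmxA XX mul1mx.
have {}XP := XP X Xe XS.
have PP : dbl J Q *m dbl J Q = dbl J Q by rewrite dbl_mul// QQ.
have rot := rotation_component GX QT QQ QI QJQ QD.
set P := dbl J Q in eP XP PP rot.
have X'E : X *m (1%:M - (P + P)) = X + (P + P).
  by rewrite mulmxBr mulmx1 mulmxDr XP -opprD opprK.
rewrite X'E in rot.
apply: (connected_component_trans _ (connected_component_sym rot)).
have GX' : G (X + (P + P)) by exact: connected_component_sub rot.
apply: IH GX'; apply: (leq_trans _ (_ : \rank (kermx (1%:M + X)) <= k)%N) => //.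
(* Multiplying by [P] on the right kills [1 + X] and leaves [2 M P = 0]. *)
have ker p (M : 'M[R]_(p, N)) : M *m (1%:M + (X + (P + P))) = 0 ->
    M *m P = 0 /\ M *m (1%:M + X) = 0.
  move=> MX; rewrite addrA mulmxDr in MX.
  have XP0 : (1%:M + X) *m P = 0 by rewrite mulmxDl mul1mx XP subrr.
  have PPP : (P + P) *m P = P + P by rewrite mulmxDl PP.
  have MP : M *m P = 0.
    have /eqP : (M *m (1%:M + X) + M *m (P + P)) *m P = 0 by rewrite MX mul0mx.
    rewrite mulmxDl -[M *m _ *m P]mulmxA XP0 mulmx0 add0r -mulmxA PPP mulmxDr.
    rewrite -[M *m P]scale1r -scalerDl scaler_eq0 -(natrD _ 1 1) pnatr_eq0 /=.
    by move=> /eqP; rewrite scale1r.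
  by split=> //; rewrite (mulmxDr M P P) MP !addr0 in MX.
(* The inclusion of kernels is strict: [e] is in the old kernel, but [e P = e] keeps it out of the
   new one. *)
apply: rank_ltmx; rewrite ltmxE; apply/andP; split.
  by apply/sub_kermxP; have [] := ker _ _ (mulmx_ker (1%:M + (X + (P + P)))).
apply/negP => sub; have : (e <= kermx (1%:M + (X + (P + P))))%MS.
  by apply: submx_trans sub; exact/sub_kermxP.
move=> /sub_kermxP /ker[]; rewrite eP => e0 _.
by move: v0; rewrite -(scalerK a0 v) -/e e0 scaler0 eqxx.
Qed.

Lemma orth_commutant_connected : connected G.
Proof.
have -> : G = connected_component G 1%:M.
  apply/seteqP; split; [exact: orth_commutant_component|].
  exact: connected_component_sub.
exact: component_connected.
Qed.

End OrthogonalCommutant.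

(** * The structures cutting out U and Sp among real matrices *)

Section BlockStructures.
Context {R : realType}.

Lemma imxE m : @imx R m = block_mx 0 (- 1%:M) 1%:M 0.
Proof. by []. Qed.

Lemma imx_tr m : (@imx R m)^T = - imx.
Proof.
by rewrite /imx tr_block_mx opp_block_mx !trmx0 linearN/= trmx1 !oppr0 opprK.
Qed.

Lemma imx2 m : @imx R m *m imx = - 1%:M.
Proof.
rewrite /imx mulmx_block !(mulmx0, mul0mx, mulmx1, mul1mx, addr0, add0r).
by rewrite [in RHS](@scalar_mx_block _ m m) opp_block_mx !oppr0 ?mulNmx ?mulmx1.
Qed.

Variable r : nat.

(* The antilinear map [v |-> S \bar v] with [S = [[0, -1], [1, 0]]], whose
   commutant consists of the complex matrices [[A, - \bar B], [B, \bar A]]. *)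
Definition jmx : 'M[R]_((r + r) + (r + r)) := block_mx imx 0 0 (- imx).

(* Commuting with [dmx] means [B = 0] in the above block form. *)
Definition dmx : 'M[R]_((r + r) + (r + r)) :=
  block_mx (block_mx 1%:M 0 0 (- 1%:M)) 0 0 (block_mx 1%:M 0 0 (- 1%:M)).

Local Notation I := (@imx R (r + r)).
Local Notation Z := (mulmx0, mul0mx, mulmx1, mul1mx, addr0, add0r, mulmxN,
  mulNmx, oppr0, opprK).

Lemma jmx_tr : jmx^T = - jmx.
Proof.
by rewrite /jmx tr_block_mx (opp_block_mx imx) !trmx0 linearN/= imx_tr !Z.
Qed.

Lemma jmx2 : jmx *m jmx = - 1%:M.
Proof.
rewrite /jmx mulmx_block !Z imx2.
by rewrite [in RHS](@scalar_mx_block _ (r + r) (r + r)) opp_block_mx !Z.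
Qed.

Lemma dmx_tr : dmx^T = dmx.
Proof. by rewrite /dmx !tr_block_mx !trmx0 !linearN/= !trmx1. Qed.

Lemma dmx2 : dmx *m dmx = 1%:M.
Proof.
rewrite /dmx (mulmx_block (block_mx _ _ _ _)) !Z mulmx_block !Z.
by rewrite -!scalar_mx_block.
Qed.

Lemma imx_jmx : I *m jmx = - (jmx *m I).
Proof.
rewrite /jmx (imxE (r + r)) (mulmx_block 0) (mulmx_block imx) !Z.
by rewrite (opp_block_mx 0 (- imx)) !Z.
Qed.

Lemma dmx_imx : dmx *m I = I *m dmx.
Proof. by rewrite /dmx (imxE (r + r)) !mulmx_block !Z. Qed.

Lemma dmx_jmx : dmx *m jmx = - (jmx *m dmx).
Proof.
pose d : 'M[R]_(r + r) := block_mx 1%:M 0 0 (- 1%:M).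
have e : d *m imx = - (imx *m d).
  by rewrite /d imxE !mulmx_block !Z opp_block_mx !Z.
rewrite /dmx /jmx -/d; move: d e => d e.
rewrite (mulmx_block d) (mulmx_block imx) !Z e.
by rewrite (opp_block_mx (imx *m d)) !Z.
Qed.

Lemma block_structure_tr b s : structure I jmx dmx b s -> s^T = s \/ s^T = - s.
Proof.
by apply: structure_tr; [exact: imx_tr|exact: jmx_tr|exact: dmx_tr].
Qed.

Definition gmx b := orth_commutant I jmx dmx b.

Lemma stage0_gmx b J : stage (structure I jmx dmx b) J 0 = gmx b.
Proof.
apply/seteqP; split=> X; first by case.
by move=> [XX XS]; split => // i; rewrite ltn0 andbF.
Qed.

Lemma gmx_connected b : connected (gmx b).
Proof.
apply: orth_commutant_connected.
- exact: imx_tr.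
- exact: imx2.
- exact: jmx_tr.
- exact: jmx2.
- exact: dmx_tr.
- exact: dmx2.
- exact: imx_jmx.
- exact: dmx_imx.
- exact: dmx_jmx.
Qed.

Lemma preimage_gmx_connected b : connected (realmx @^-1` gmx b).
Proof.
have -> : realmx @^-1` gmx b = unreal @` gmx b.
  apply/seteqP; split=> [x xG|_ [X [XX XS] <-]].
    by exists (realmx x) => //; rewrite realmxK.
  by rewrite /= unrealK//; apply: XS; constructor 1.
apply: connected_continuous_connected; first exact: gmx_connected.
exact/continuous_subspaceT/unreal_continuous.
Qed.

End BlockStructures.

Arguments jmx {R r}.
Arguments dmx {R r}.
Arguments gmx {R r}.

(** * U and Sp as orthogonal commutants *)

Section ComplexMatrices.
Local Open Scope complex_scope.
Local Open Scope sesquilinear_scope.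
Context {R : realType}.

Lemma cplx_inj m : injective (@cplx R m).
Proof.
move=> [x1 x2] [y1 y2] xy; congr pair; apply/matrixP => i j;
by have /matrixP/(_ i j) := xy; rewrite !mxE => -[].
Qed.

Lemma cplx_surj m (A : 'M[R[i]]_m) :
  A = cplx ((map_mx (@complex.Re R) A, map_mx (@complex.Im R) A) : cmat R m).
Proof. by apply/matrixP => i j; rewrite !mxE /=; case: (A i j). Qed.

Lemma conj_cplx m (x : cmat R m) : conj_mx (cplx x) = cplx ((x.1, - x.2) : cmat R m).
Proof. by apply/matrixP => i j; rewrite !mxE. Qed.

Lemma opp_cplx m (x : cmat R m) : - cplx x = cplx (- x).
Proof. by apply/matrixP => i j; rewrite !mxE. Qed.

Lemma cplx_block m (a b c d : cmat R m) :
  block_mx (cplx a) (cplx b) (cplx c) (cplx d) =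
  cplx ((block_mx a.1 b.1 c.1 d.1, block_mx a.2 b.2 c.2 d.2) : cmat R (m + m)).
Proof.
apply/matrixP => i j; rewrite !mxE.
by case: splitP => k _; rewrite !mxE; case: splitP => l _; rewrite !mxE.
Qed.

Lemma realmx_orth m (x : cmat R m) : realmx x *m (realmx x)^T =
  realmx ((x.1 *m x.1^T + x.2 *m x.2^T, x.2 *m x.1^T - x.1 *m x.2^T) : cmat R m).
Proof.
rewrite /realmx tr_block_mx mulmx_block !linearN/= !mulNmx !opprK /=.
by rewrite opprB [X in block_mx _ _ _ X]addrC [X in block_mx _ X]addrC.
Qed.

Lemma realmx1 m : realmx ((1%:M, 0) : cmat R m) = 1%:M.
Proof. by rewrite /realmx /= oppr0 -scalar_mx_block. Qed.

Lemma realmx_orthE m (x : cmat R m) : realmx x *m (realmx x)^T = 1%:M <->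
  x.1 *m x.1^T + x.2 *m x.2^T = 1%:M /\ x.2 *m x.1^T - x.1 *m x.2^T = 0.
Proof.
rewrite realmx_orth -realmx1.
by split=> [/(can_inj realmxK)[-> ->]|[-> ->]].
Qed.

(** Both sides say that the pair [y] of real and imaginary parts of [x x^*] is [(1, 0)]. *)
Lemma cplx_unitary m (x : cmat R m) :
  cplx x \is unitarymx <-> realmx x *m (realmx x)^T = 1%:M.
Proof.
pose y : cmat R m := (x.1 *m x.1^T + x.2 *m x.2^T, x.2 *m x.1^T - x.1 *m x.2^T).
have cy : cplx x *m (cplx x)^t* = cplx y.
  apply/matrixP => i j; apply/eqP; rewrite eq_complex !mxE !raddf_sum -!big_split/=.
  by apply/andP; split; apply/eqP; apply: eq_bigr => k _; rewrite !mxE /=; ring.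
have c1 : cplx ((1%:M, 0) : cmat R m) = 1%:M.
  by apply/matrixP => i j; rewrite !mxE; case: (i == j).
rewrite realmx_orth -realmx1.
split=> [/unitarymxP|/(can_inj realmxK) yE].
  by rewrite cy -c1 => /cplx_inj; rewrite /y => ->.
by apply/unitarymxP; rewrite cy /y yE.
Qed.

Lemma block_imx r (a b c d : 'M[R]_r) :
  block_mx a b c d *m imx = block_mx b (- a) d (- c).
Proof.
rewrite imxE mulmx_block !(mulmx0, mulmxN, mulmx1, addr0, add0r).
by [].
Qed.

Lemma imx_block r (a b c d : 'M[R]_r) :
  imx *m block_mx a b c d = block_mx (- c) (- d) a b.
Proof.
rewrite imxE mulmx_block !(mul0mx, mulNmx, mul1mx, addr0, add0r).
by [].
Qed.

Lemma jmx_commuteE r (x : cmat R (r + r)) :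
  realmx x *m jmx = jmx *m realmx x <->
  x.1 *m imx = imx *m x.1 /\ x.2 *m imx = - (imx *m x.2).
Proof.
have -> : realmx x *m jmx =
    block_mx (x.1 *m imx) (x.2 *m imx) (x.2 *m imx) (- (x.1 *m imx)).
  rewrite /realmx /jmx (mulmx_block x.1).
  by rewrite !(mulmx0, mulmxN, mulNmx, opprK, addr0, add0r).
have -> : jmx *m realmx x =
    block_mx (imx *m x.1) (- (imx *m x.2)) (- (imx *m x.2)) (- (imx *m x.1)).
  rewrite /realmx /jmx (mulmx_block imx).
  by rewrite !(mul0mx, mulmxN, mulNmx, opprK, addr0, add0r).
by split=> [/eq_block_mx[-> -> _ _]|[-> ->]].
Qed.

Lemma quaternionicE r (x : cmat R (r + r)) :
  realmx x *m jmx = jmx *m realmx x <->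
  exists a b : cmat R r, x = (block_mx a.1 (- b.1) b.1 a.1,
                              block_mx a.2 b.2 b.2 (- a.2)).
Proof.
split=> [/jmx_commuteE[]|[a [b ->]]]; last first.
  by apply/jmx_commuteE; rewrite /= !block_imx !imx_block opp_block_mx !opprK.
case: x => x1 x2 /=; rewrite -(submxK x1) -(submxK x2).
rewrite !block_imx !imx_block opp_block_mx !opprK.
move=> /eq_block_mx[-> _ -> _] /eq_block_mx[-> _ -> _].
by exists (ulsubmx x1, ulsubmx x2), (dlsubmx x1, dlsubmx x2).
Qed.

Lemma quaternionicP r (x : cmat R (r + r)) :
  realmx x *m jmx = jmx *m realmx x <->
  exists A B : 'M[R[i]]_r, cplx x = block_mx A (- conj_mx B) B (conj_mx A).
Proof.
have blk (a b : cmat R r) : block_mx (cplx a) (- conj_mx (cplx b)) (cplx b)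
    (conj_mx (cplx a)) =
    cplx ((block_mx a.1 (- b.1) b.1 a.1, block_mx a.2 b.2 b.2 (- a.2))
      : cmat R (r + r)).
  by rewrite !conj_cplx opp_cplx cplx_block /= opprK.
split=> [/quaternionicE[a [b ->]]|[A [B]]].
  by exists (cplx a), (cplx b); rewrite blk.
rewrite (cplx_surj A) (cplx_surj B) blk => /cplx_inj xE.
by apply/quaternionicE; do 2!eexists; exact: xE.
Qed.

Lemma SpE r : @Sp R r = realmx @^-1` gmx false.
Proof.
apply/seteqP; split=> x.
  move=> [/cplx_unitary xx /quaternionicP xj]; split=> //.
  by apply: commutesP => //; exact: realmx_imx.
move=> [xx xS]; split; first exact/cplx_unitary.
by apply/quaternionicP/xS; constructor 2.
Qed.

Lemma UE r : @U R r = realmx @^-1` gmx true.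
Proof.
have uni (a : cmat R r) :
  cplx ((block_mx a.1 0 0 a.1, block_mx a.2 0 0 (- a.2)) : cmat R (r + r))
     \is unitarymx <-> cplx a \is unitarymx.
  rewrite !cplx_unitary !realmx_orthE /= !tr_block_mx !mulmx_block !trmx0.
  rewrite !(mulmx0, mul0mx, addr0, add0r) linearN/= !(mulmxN, mulNmx) opprK.
  rewrite (opp_block_mx (a.1 *m _)) oppr0 opprK !add_block_mx !addr0.
  rewrite -block_mx0 (scalar_mx_block r r 1).
  split=> [[/eq_block_mx[-> _ _ _] /eq_block_mx[-> _ _ _]]//|[-> ad]].
  by split=> //; rewrite ad addrC -[_ - _]opprB ad oppr0.
have dE (a b : cmat R r) (x : cmat R (r + r) :=
    (block_mx a.1 (- b.1) b.1 a.1, block_mx a.2 b.2 b.2 (- a.2))) :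
  realmx x *m dmx = dmx *m realmx x <-> b = 0.
  have self_opp (c : 'M[R]_r) : c = - c -> c = 0.
    move=> /eqP; rewrite -addr_eq0 -[c]scale1r -scalerDl scaler_eq0.
    by rewrite -(natrD _ 1 1) pnatr_eq0 /= => /eqP ->; rewrite scaler0.
  pose d : 'M[R]_(r + r) := block_mx 1%:M 0 0 (- 1%:M).
  have ld (p q u v : 'M[R]_r) : d *m block_mx p q u v = block_mx p q (- u) (- v).
    by rewrite /d mulmx_block !(mul0mx, mulNmx, mul1mx, addr0, add0r).
  have rd (p q u v : 'M[R]_r) : block_mx p q u v *m d = block_mx p (- q) u (- v).
    by rewrite /d mulmx_block !(mulmx0, mulmxN, mulmx1, addr0, add0r).
  have -> : realmx x *m dmx = block_mx (x.1 *m d) (- x.2 *m d) (x.2 *m d) (x.1 *m d).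
    by rewrite /realmx /dmx (mulmx_block x.1) !mulmx0 !addr0 !add0r.
  have -> : dmx *m realmx x = block_mx (d *m x.1) (d *m - x.2) (d *m x.2) (d *m x.1).
    by rewrite /realmx /dmx (mulmx_block d) !mul0mx !addr0 !add0r.
  rewrite /x /= mulNmx mulmxN !ld !rd.
  split=> [/eq_block_mx[/eq_block_mx[_ _ b1 _] _ /eq_block_mx[_ _ b2 _] _]|->].
    by rewrite [LHS]surjective_pairing (self_opp _ b1) (self_opp _ b2).
  by rewrite /= !oppr0.
apply/seteqP; split=> x.
  move=> [A Au]; rewrite (cplx_surj A) in Au *.
  set a : cmat R r := (_, _) in Au *; rewrite conj_cplx.
  have -> : 0 = cplx (0 : cmat R r) by apply/matrixP => i j; rewrite !mxE.
  rewrite cplx_block /= => /cplx_inj xE.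
  have xE0 : x = (block_mx a.1 (- (0 : cmat R r).1) (0 : cmat R r).1 a.1,
      block_mx a.2 (0 : cmat R r).2 (0 : cmat R r).2 (- a.2)).
    by rewrite /= oppr0.
  have xx : realmx x *m (realmx x)^T = 1%:M.
    by rewrite xE; apply: (iffLR (cplx_unitary _)); exact: (iffRL (uni a)).
  split=> //; apply: commutesP; first exact: realmx_imx.
    by apply: (iffRL (quaternionicE x)); exists a, 0.
  by move=> _; rewrite xE0; exact: (iffRL (dE a 0)).
move=> [xx xS]; move/(iffRL (cplx_unitary x)): xx => xx.
have /quaternionicE[a [b xE]] : realmx x *m jmx = jmx *m realmx x.
  by apply: xS; constructor 2.
have : realmx x *m dmx = dmx *m realmx x by apply: xS; constructor 3.
rewrite xE => /(iffLR (dE a b)) b0; rewrite xE b0 /= oppr0 in xx.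
exists (cplx a); first exact: (iffLR (uni a)).
rewrite b0 conj_cplx.
have -> : 0 = cplx (0 : cmat R r) by apply/matrixP => i j; rewrite !mxE.
by rewrite cplx_block /= oppr0.
Qed.

End ComplexMatrices.

(** * Modules over the Clifford algebra with eight generators *)

Section Halving.
Context {R : realType} {N : nat}.
Implicit Types p e K L X Y : 'M[R]_N.

(* The restriction of the projection [p] to the [+ 1]-eigenspace of [e]. *)
Definition halve p e := 2^-1 *: (p *m (1%:M + e)).

Definition proj p := p^T = p /\ p *m p = p.

Definition involution e := e^T = e /\ e *m e = 1%:M.

Definition corner p X := p *m X = X /\ X *m p = X.

Lemma halve_commute p e L : p *m L = L *m p -> e *m L = L *m e ->
  halve p e *m L = L *m halve p e.
Proof.
move=> pL eL; rewrite /halve -scalemxAl -scalemxAr; congr (_ *: _).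
by rewrite -mulmxA mulmxDl mul1mx eL -[X in X + _]mulmx1 -mulmxDr mulmxA pL
  -mulmxA.
Qed.

Variables (p e : 'M[R]_N).
Hypotheses (pP : proj p) (eP : involution e) (pe : p *m e = e *m p).

Lemma halve_mul_inv : halve p e *m e = halve p e.
Proof.
have [_ e2] := eP; rewrite /halve -scalemxAl -mulmxA mulmxDl mul1mx e2.
by rewrite addrC.
Qed.

Lemma inv_mul_halve : e *m halve p e = halve p e.
Proof. by rewrite -halve_commute// halve_mul_inv. Qed.

Lemma mul_halve : p *m halve p e = halve p e.
Proof. by have [_ p2] := pP; rewrite /halve -scalemxAr mulmxA p2. Qed.

Lemma halve_mul : halve p e *m p = halve p e.
Proof. by rewrite halve_commute// mul_halve. Qed.

Lemma halve_proj : proj (halve p e).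
Proof.
have [[pT p2] [eT e2]] := (pP, eP); split.
  rewrite /halve linearZ/= trmx_mul linearD/= trmx1 eT pT.
  by rewrite mulmxDl mulmxDr mul1mx mulmx1 pe.
rewrite {2}/halve -scalemxAr mulmxA halve_mul mulmxDr mulmx1 halve_mul_inv.
by rewrite -[halve p e]scale1r -scalerDl scalerA -(natrD _ 1 1) mulVf ?pnatr_eq0.
Qed.

Variable K : 'M[R]_N.
Hypotheses (K_tr : K^T = - K) (K2 : K *m K = - 1%:M).
Hypotheses (Kp : K *m p = p *m K) (Ke : K *m e = - (e *m K)).

(** [K] anticommutes with [e], so it sends the + 1 eigenspace to the - 1 eigenspace. *)
Lemma halve_sandwich : halve p e *m K *m halve p e = 0.
Proof.
have : halve p e *m K *m halve p e = - (halve p e *m K *m halve p e).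
  rewrite -{1}halve_mul_inv -(mulmxA _ e K).
  have -> : e *m K = - (K *m e) by rewrite Ke opprK.
  by rewrite mulmxN mulNmx mulmxA -(mulmxA _ e) inv_mul_halve.
move=> /eqP; rewrite -addr_eq0 -[X in X + X]scale1r -scalerDl scaler_eq0.
by rewrite -(natrD _ 1 1) pnatr_eq0 /= => /eqP.
Qed.

Lemma corner_sandwich X Y : corner (halve p e) X -> corner (halve p e) Y ->
  X *m K *m Y = 0.
Proof.
move=> [_ XP] [PY _]; rewrite -XP -PY.
rewrite -!mulmxA (mulmxA K) (mulmxA _ _ Y) (mulmxA (halve p e)) halve_sandwich.
by rewrite mul0mx mulmx0.
Qed.

Lemma corner_dbl X : corner (halve p e) X -> corner p (dbl K X).
Proof.
move=> [PX XP].
have pX : p *m X = X by rewrite -PX mulmxA mul_halve.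
have Xp : X *m p = X by rewrite -XP -mulmxA halve_mul.
split; first by rewrite -dbl_mull// pX.
apply: trmx_inj; have [pT _] := pP.
by rewrite trmx_mul dbl_tr pT -dbl_mull// -{1}pT -trmx_mul Xp.
Qed.

Lemma corner_dbl_mul X Y : corner (halve p e) X -> corner (halve p e) Y ->
  dbl K X *m dbl K Y = dbl K (X *m Y).
Proof. by move=> cX cY; apply: dbl_mul => //; exact: corner_sandwich. Qed.

Lemma corner_dbl_compress X : corner (halve p e) X ->
  halve p e *m dbl K X *m halve p e = X.
Proof.
move=> [PX XP]; rewrite mulmxDr mulmxDl PX XP !mulmxA.
have -> : halve p e *m K *m X = 0.
  by rewrite -PX mulmxA halve_sandwich mul0mx.
by rewrite !mul0mx addr0.
Qed.

(** Conjugation by [K] exchanges the two halves of [p], which add up to [p]. *)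
Lemma dbl_halve : dbl K (halve p e) = p.
Proof.
have KK : K *m K^T = 1%:M by rewrite K_tr mulmxN K2 opprK.
have E : K *m halve p e *m K^T = 2^-1 *: (p *m (1%:M - e)).
  rewrite /halve -scalemxAr -scalemxAl; congr (_ *: _).
  rewrite mulmxA Kp -!mulmxA; congr (_ *m _).
  by rewrite mulmxA mulmxDr mulmx1 Ke mulmxBl KK -mulmxA KK mulmx1.
rewrite /dbl E /halve -scalerDr -mulmxDr addrACA subrr addr0.
rewrite mulmxDr mulmx1 -[X in _ *: (X + X)]scale1r -scalerDl scalerA.
by rewrite -(natrD _ 1 1) mulVf ?pnatr_eq0// scale1r.
Qed.

Lemma halve_trace : \tr (halve p e) = \tr p / 2.
Proof.
have KK : K^T *m K = 1%:M by rewrite K_tr mulNmx K2 opprK.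
by rewrite -[in RHS]dbl_halve dbl_trace// -(mulr_natr (\tr _)) mulfK ?pnatr_eq0.
Qed.

End Halving.

(** * Words in the Clifford generators and their signs *)

Section CliffordMonomials.
Context {R : realType} {N : nat} (J : nat -> 'M[R]_N) (m : nat).
Hypothesis J_sq : forall i, (0 < i <= m)%N -> J i *m J i = - 1%:M.
Hypothesis J_anti : forall i j, (0 < i <= m)%N -> (0 < j <= m)%N -> i != j ->
  J i *m J j = - (J j *m J i).
Hypothesis J_tr : forall i, (0 < i <= m)%N -> (J i)^T = - J i.

Definition mono (l : seq nat) : 'M[R]_N := foldr (fun i X => J i *m X) 1%:M l.

Definition indices (l : seq nat) := all (fun i => (0 < i <= m)%N) l.

(* Parities of the signs in [J i * mono l = +- mono l * J i],
   [mono l * mono k = +- mono k * mono l] and [mono l * mono l = +- 1]. *)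
Definition sign1 i (l : seq nat) := odd (count (predC1 i) l).
Definition sign2 (l k : seq nat) := odd (\sum_(i <- l) sign1 i k).
Fixpoint sign_sq (l : seq nat) :=
  if l is i :: k then ~~ (sign1 i k (+) sign_sq k) else false.

Lemma mono_commute1 i l : (0 < i <= m)%N -> indices l ->
  J i *m mono l = (-1) ^+ sign1 i l *: (mono l *m J i).
Proof.
move=> im; elim: l => [_|j l IH /andP[jm lm]].
  by rewrite /mono /= mulmx1 mul1mx scale1r.
rewrite /= -mulmxA -/(mono l) /sign1/= oddD oddb -/(sign1 i l).
have [->|ij] := eqVneq j i.
  by rewrite [in LHS]IH// addFb -scalemxAr mulmxA.
by rewrite mulmxA J_anti// 1?eq_sym// mulNmx -!mulmxA IH// -scalemxAr
  signr_addb expr1 mulN1r scaleNr mulmxA.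
Qed.

Lemma mono_commute l k : indices l -> indices k ->
  mono l *m mono k = (-1) ^+ sign2 l k *: (mono k *m mono l).
Proof.
elim: l => [_ _|i l IH /andP[im lm] km].
  by rewrite /sign2 big_nil /mono /= mulmx1 mul1mx scale1r.
rewrite /sign2 big_cons oddD oddb -/(sign2 l k) /= -/(mono l) -mulmxA IH//.
rewrite -scalemxAr (mulmxA _ (mono k)) mono_commute1// -scalemxAl scalerA.
rewrite -signr_addb addbC.
by rewrite mulmxA.
Qed.

Lemma mono_sq l : indices l -> mono l *m mono l = (-1) ^+ sign_sq l *: 1%:M.
Proof.
elim: l => [_|i l IH /andP[im lm]]; first by rewrite /= mulmx1 scale1r.
rewrite /= -/(mono l) -mulmxA (mulmxA (mono l)).
have -> : mono l *m J i = (-1) ^+ sign1 i l *: (J i *m mono l).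
  by rewrite mono_commute1// scalerA -expr2 sqrr_sign scale1r.
rewrite -scalemxAl -scalemxAr !mulmxA J_sq// mulNmx mul1mx mulNmx IH//.
by rewrite scalerN scalerA -signr_addb signrN scaleNr.
Qed.

Lemma mono_orth l : indices l -> (mono l)^T *m mono l = 1%:M.
Proof.
elim: l => [_|i l IH /andP[im lm]]; first by rewrite /= trmx1 mulmx1.
rewrite /= -/(mono l) trmx_mul -mulmxA (mulmxA _ (J i)) J_tr// mulNmx J_sq//.
by rewrite opprK mul1mx IH.
Qed.

Lemma mono_involution l : indices l -> ~~ sign_sq l -> involution (mono l).
Proof.
move=> lm sl; have sq := mono_sq lm; rewrite (negbTE sl) expr0 scale1r in sq.
by split => //; rewrite -[LHS]mulmx1 -sq mulmxA mono_orth// mul1mx.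
Qed.

Lemma commutes_mono X l : (forall i, i \in l -> X *m J i = J i *m X) ->
  X *m mono l = mono l *m X.
Proof.
elim: l => [|i l IH] XJ; first by rewrite /= mulmx1 mul1mx.
rewrite /= -/(mono l) mulmxA XJ ?mem_head// -mulmxA IH ?mulmxA// => j jl.
by apply: XJ; rewrite inE jl orbT.
Qed.

End CliffordMonomials.

Section CliffordTower.
Context {R : realType} {N : nat} (J : nat -> 'M[R]_N).
Hypothesis J_sq : forall i, (0 < i <= 8)%N -> J i *m J i = - 1%:M.
Hypothesis J_anti : forall i j, (0 < i <= 8)%N -> (0 < j <= 8)%N -> i != j ->
  J i *m J j = - (J j *m J i).
Hypothesis J_tr : forall i, (0 < i <= 8)%N -> (J i)^T = - J i.
Implicit Types (X Y a b h : 'M[R]_N) (i : nat).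

Local Notation mono := (mono J).
(** Words of length 3 or 7 square to 1, and words of odd length commute when they share an odd
    number of letters. *)
Let w : 'M[R]_N := mono [:: 1; 2; 3; 4; 5; 6; 7]%N.
Let e1 : 'M[R]_N := mono [:: 1; 2; 3]%N.
Let e2 : 'M[R]_N := mono [:: 1; 4; 5]%N.
Let e3 : 'M[R]_N := mono [:: 2; 4; 6]%N.

(* In each step half of the range is kept, the other half being its image under
   [J 8], [J 4], [J 2] and [J 1] respectively. *)
Definition tower1 := halve 1%:M w.
Definition tower2 := halve tower1 e1.
Definition tower3 := halve tower2 e2.
Definition tower4 := halve tower3 e3.

Local Notation p1 := tower1.
Local Notation p2 := tower2.
Local Notation p3 := tower3.
Local Notation p4 := tower4.

Let mono_com l k : indices 8 l -> indices 8 k -> ~~ sign2 l k ->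
  mono l *m mono k = mono k *m mono l.
Proof.
by move=> l8 k8 s; rewrite (mono_commute J_anti l8 k8) (negbTE s) expr0 scale1r.
Qed.

Let J_mono_com i l : (0 < i <= 8)%N -> indices 8 l -> ~~ sign1 i l ->
  J i *m mono l = mono l *m J i.
Proof.
by move=> l8 k8 s; rewrite (mono_commute1 J_anti l8 k8) (negbTE s) expr0 scale1r.
Qed.

Let J_mono_anti i l : (0 < i <= 8)%N -> indices 8 l -> sign1 i l ->
  J i *m mono l = - (mono l *m J i).
Proof.
by move=> l8 k8 s; rewrite (mono_commute1 J_anti l8 k8) s expr1 scaleN1r.
Qed.

Let invol l : indices 8 l -> ~~ sign_sq l -> involution (mono l).
Proof. exact: mono_involution. Qed.

Let w_invol : involution w. Proof. exact: invol. Qed.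
Let e1_invol : involution e1. Proof. exact: invol. Qed.
Let e2_invol : involution e2. Proof. exact: invol. Qed.
Let e3_invol : involution e3. Proof. exact: invol. Qed.

(** These signs are decided by computation; [unlock] opens the big sum in [sign2]. *)
Let we1 : w *m e1 = e1 *m w.
Proof. by apply: mono_com; rewrite // /sign2 unlock. Qed.
Let we2 : w *m e2 = e2 *m w.
Proof. by apply: mono_com; rewrite // /sign2 unlock. Qed.
Let we3 : w *m e3 = e3 *m w.
Proof. by apply: mono_com; rewrite // /sign2 unlock. Qed.
Let e1e2 : e1 *m e2 = e2 *m e1.
Proof. by apply: mono_com; rewrite // /sign2 unlock. Qed.
Let e1e3 : e1 *m e3 = e3 *m e1.
Proof. by apply: mono_com; rewrite // /sign2 unlock. Qed.
Let e2e3 : e2 *m e3 = e3 *m e2.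
Proof. by apply: mono_com; rewrite // /sign2 unlock. Qed.

Lemma tower1_commute X : X *m w = w *m X -> X *m p1 = p1 *m X.
Proof.
by move=> Xw; apply/esym/halve_commute; rewrite ?mul1mx ?mulmx1 ?Xw.
Qed.

Lemma tower2_commute X : X *m w = w *m X -> X *m e1 = e1 *m X ->
  X *m p2 = p2 *m X.
Proof. by move=> Xw Xe; apply/esym/halve_commute; rewrite // tower1_commute. Qed.

Lemma tower3_commute X : X *m w = w *m X -> X *m e1 = e1 *m X ->
  X *m e2 = e2 *m X -> X *m p3 = p3 *m X.
Proof.
by move=> Xw Xe1 Xe2; apply/esym/halve_commute; rewrite // tower2_commute.
Qed.

Lemma tower4_commute X : X *m w = w *m X -> X *m e1 = e1 *m X ->
  X *m e2 = e2 *m X -> X *m e3 = e3 *m X -> X *m p4 = p4 *m X.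
Proof.
by move=> Xw Xe1 Xe2 Xe3; apply/esym/halve_commute; rewrite // tower3_commute.
Qed.

Let proj1 : proj (1%:M : 'M[R]_N). Proof. by split; rewrite ?trmx1 ?mulmx1. Qed.
Let p0w : 1%:M *m w = w *m 1%:M. Proof. by rewrite mul1mx mulmx1. Qed.
Let p1e1 : p1 *m e1 = e1 *m p1. Proof. exact/esym/tower1_commute. Qed.
Let p2e2 : p2 *m e2 = e2 *m p2. Proof. exact/esym/tower2_commute. Qed.
Let p3e3 : p3 *m e3 = e3 *m p3. Proof. exact/esym/tower3_commute. Qed.
Let p1_proj : proj p1. Proof. exact: halve_proj. Qed.
Let p2_proj : proj p2. Proof. exact: halve_proj. Qed.
Let p3_proj : proj p3. Proof. exact: halve_proj. Qed.
Lemma tower4_proj : proj p4. Proof. exact: halve_proj. Qed.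

(** A generator commutes with the words of odd length containing it and anticommutes with those
    omitting it; this dictates the choice of 8, 4, 2 and 1. *)
Let J8_1 : J 8 *m 1%:M = 1%:M *m J 8. Proof. by rewrite mul1mx mulmx1. Qed.
Let J8w : J 8 *m w = - (w *m J 8). Proof. exact: J_mono_anti. Qed.
Let J4p1 : J 4 *m p1 = p1 *m J 4.
Proof. by apply: tower1_commute; exact: J_mono_com. Qed.
Let J4e1 : J 4 *m e1 = - (e1 *m J 4). Proof. exact: J_mono_anti. Qed.
Let J2p2 : J 2 *m p2 = p2 *m J 2.
Proof. by apply: tower2_commute; exact: J_mono_com. Qed.
Let J2e2 : J 2 *m e2 = - (e2 *m J 2). Proof. exact: J_mono_anti. Qed.
Let J1p3 : J 1 *m p3 = p3 *m J 1.
Proof. by apply: tower3_commute; exact: J_mono_com. Qed.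
Let J1e3 : J 1 *m e3 = - (e3 *m J 1). Proof. exact: J_mono_anti. Qed.

Let J1t : (J 1)^T = - J 1. Proof. exact: J_tr. Qed.
Let J2t : (J 2)^T = - J 2. Proof. exact: J_tr. Qed.
Let J4t : (J 4)^T = - J 4. Proof. exact: J_tr. Qed.
Let J8t : (J 8)^T = - J 8. Proof. exact: J_tr. Qed.
Let J1s : J 1 *m J 1 = - 1%:M. Proof. exact: J_sq. Qed.
Let J2s : J 2 *m J 2 = - 1%:M. Proof. exact: J_sq. Qed.
Let J4s : J 4 *m J 4 = - 1%:M. Proof. exact: J_sq. Qed.
Let J8s : J 8 *m J 8 = - 1%:M. Proof. exact: J_sq. Qed.

Lemma tower1_sandwich : p1 *m J 8 *m p1 = 0.
Proof. exact: halve_sandwich. Qed.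

Lemma tower1_dbl : dbl (J 8) p1 = 1%:M.
Proof. exact: dbl_halve. Qed.

Lemma tower4_trace : \tr p4 = N%:R / 16.
Proof.
rewrite (halve_trace J1t J1s J1p3 J1e3) (halve_trace J2t J2s J2p2 J2e2).
rewrite (halve_trace J4t J4s J4p1 J4e1) (halve_trace J8t J8s J8_1 J8w) mxtrace1.
by field.
Qed.

(* Eight copies of the corner of [p4], permuted by [J 1], ..., [J 7], fill the
   range of [p1]; [spread X] acts on each of them as [X]. *)
Definition spread X := dbl (J 4) (dbl (J 2) (dbl (J 1) X)).

Let corner1 X : corner p4 X -> corner p3 (dbl (J 1) X).
Proof. exact: corner_dbl. Qed.
Let corner2 X : corner p4 X -> corner p2 (dbl (J 2) (dbl (J 1) X)).
Proof. by move=> /corner1; exact: corner_dbl. Qed.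

Lemma spread_corner X : corner p4 X -> corner p1 (spread X).
Proof. by move=> /corner2; exact: corner_dbl. Qed.

Lemma spread_mul X Y : corner p4 X -> corner p4 Y ->
  spread X *m spread Y = spread (X *m Y).
Proof.
move=> cX cY; rewrite /spread.
rewrite (corner_dbl_mul e1_invol p1e1 J4t J4s J4e1 (corner2 cX) (corner2 cY)).
rewrite (corner_dbl_mul e2_invol p2e2 J2t J2s J2e2 (corner1 cX) (corner1 cY)).
by rewrite (corner_dbl_mul e3_invol p3e3 J1t J1s J1e3 cX cY).
Qed.

Lemma spread_tr X : (spread X)^T = spread X^T.
Proof. by rewrite /spread !dbl_tr. Qed.

Lemma spread_commute_comm X Y : Y *m J 1 = J 1 *m Y -> Y *m J 2 = J 2 *m Y ->
  Y *m J 4 = J 4 *m Y -> X *m Y = Y *m X -> spread X *m Y = Y *m spread X.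
Proof.
by move=> Y1 Y2 Y4 XY; do 3!(apply: dbl_commute_comm => //).
Qed.

Lemma spread_linear : linear spread.
Proof. by move=> c X Y; rewrite /spread !dbl_linear. Qed.

Lemma spread_tower4 : spread p4 = p1.
Proof.
rewrite /spread (dbl_halve J1t J1s J1p3 J1e3) (dbl_halve J2t J2s J2p2 J2e2).
exact: dbl_halve.
Qed.

(** As [p4 = p4 p3 p2], the compression can pass through [p2], [p3] and [p4] in turn, each undoing
    one doubling. *)
Lemma spread_compress X : corner p4 X -> p4 *m spread X *m p4 = X.
Proof.
move=> cX.
have E4 : p4 = p4 *m p3 *m p2.
  by rewrite -mulmxA (halve_mul p2_proj p2e2) (halve_mul p3_proj p3e3).
have E4' : p4 = p2 *m (p3 *m p4).
  have [t2 _] := p2_proj; have [t3 _] := p3_proj; have [t4 _] := tower4_proj.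
  by rewrite -{1}t4 {1}E4 !trmx_mul t2 t3 t4.
rewrite {1}E4 {2}E4' /spread.
have -> (Y : 'M[R]_N) : p4 *m p3 *m p2 *m Y *m (p2 *m (p3 *m p4)) =
    p4 *m (p3 *m (p2 *m Y *m p2) *m p3) *m p4 by rewrite !mulmxA.
rewrite (corner_dbl_compress e1_invol p1e1 J4e1 (corner2 cX)).
rewrite (corner_dbl_compress e2_invol p2e2 J2e2 (corner1 cX)).
exact: corner_dbl_compress.
Qed.

Lemma spread_trace X : \tr (spread X) = \tr X *+ 8.
Proof.
have KK i : (0 < i <= 8)%N -> (J i)^T *m J i = 1%:M.
  by move=> i8; rewrite J_tr// mulNmx J_sq// opprK.
by rewrite /spread !dbl_trace ?KK// -!mulrnA.
Qed.

Lemma spread_mull X Y : (forall i, (0 < i <= 7)%N -> X *m J i = J i *m X) ->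
  spread (X *m Y) = X *m spread Y.
Proof. by move=> XJ; rewrite /spread !dbl_mull// XJ. Qed.

Let J_prod i X : (0 < i <= 8)%N -> J i *m (J i *m X) = - X.
Proof. by move=> i8; rewrite mulmxA J_sq// mulNmx mul1mx. Qed.

(** [J 3], [J 5], [J 6] and [J 7] are products of [J 1], [J 2], [J 4] and the four involutions. *)
Lemma commutes_generators X : X *m w = w *m X ->
  X *m e1 = e1 *m X -> X *m e2 = e2 *m X -> X *m e3 = e3 *m X ->
  X *m J 1 = J 1 *m X -> X *m J 2 = J 2 *m X -> X *m J 4 = J 4 *m X ->
  forall i, (0 < i <= 7)%N -> X *m J i = J i *m X.
Proof.
move=> Xw Xe1 Xe2 Xe3 X1 X2 X4.
have cM (A B : 'M[R]_N) : X *m A = A *m X -> X *m B = B *m X ->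
    X *m (A *m B) = A *m B *m X.
  by move=> XA XB; rewrite mulmxA XA -mulmxA XB mulmxA.
have cN (A : 'M[R]_N) : X *m A = A *m X -> X *m - A = - A *m X.
  by move=> XA; rewrite mulmxN XA mulNmx.
have X3 : X *m J 3 = J 3 *m X.
  have -> : J 3 = J 2 *m (J 1 *m e1).
    by rewrite /e1 /mono /= J_prod// mulmxN J_prod// mulmx1 opprK.
  exact: cM _ _ X2 (cM _ _ X1 Xe1).
have X5 : X *m J 5 = J 5 *m X.
  have -> : J 5 = J 4 *m (J 1 *m e2).
    by rewrite /e2 /mono /= J_prod// mulmxN J_prod// mulmx1 opprK.
  exact: cM _ _ X4 (cM _ _ X1 Xe2).
have X6 : X *m J 6 = J 6 *m X.
  have -> : J 6 = J 4 *m (J 2 *m e3).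
    by rewrite /e3 /mono /= J_prod// mulmxN J_prod// mulmx1 opprK.
  exact: cM _ _ X4 (cM _ _ X2 Xe3).
have X7 : X *m J 7 = J 7 *m X.
  have -> : J 7 = J 6 *m (J 5 *m (J 4 *m (J 3 *m (J 2 *m (J 1 *m w))))).
    rewrite /w /mono /=.
    by do 6![rewrite J_prod// ?mulmxN]; rewrite !opprK mulmx1.
  exact: cM _ _ X6 (cM _ _ X5 (cM _ _ X4 (cM _ _ X3 (cM _ _ X2 (cM _ _ X1 Xw))))).
by case=> [|[|[|[|[|[|[|[|i]]]]]]]].
Qed.

Lemma tower4_corner : corner p1 p4.
Proof.
have p14 : p1 *m p4 = p4.
  have p34 : p3 *m p4 = p4 by exact: mul_halve.
  have p23 : p2 *m p3 = p3 by exact: mul_halve.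
  have p12 : p1 *m p2 = p2 by exact: mul_halve.
  by rewrite -p34 -p23 !mulmxA p12.
split=> //; have [[t1 _] [t4 _]] := (p1_proj, tower4_proj).
by apply: trmx_inj; rewrite trmx_mul t1 t4.
Qed.

(** Such an [e] acts as the identity on the range of [p4], so both products equal [X]. *)
Let corner4_com X e : involution e -> corner p4 X -> e *m p4 = p4 ->
  X *m e = e *m X.
Proof.
move=> [eT _] [PX XP] eP; have [pT _] := tower4_proj.
have Pe : p4 *m e = p4 by apply: trmx_inj; rewrite trmx_mul eT pT.
by rewrite -XP -[in LHS]mulmxA Pe -[in RHS]PX mulmxA mulmxA eP PX XP.
Qed.

(** [X] commutes with the involutions and doubling preserves this. Commutation with [J 1], [J 2],
    [J 4] is created by the respective doubling and kept by the later ones. *)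
Lemma spread_commute X i : corner p4 X -> (0 < i <= 7)%N ->
  spread X *m J i = J i *m spread X.
Proof.
move=> cX; have e3p4 : e3 *m p4 = p4 by exact: inv_mul_halve.
have e2p3 : e2 *m p3 = p3 by exact: inv_mul_halve.
have e1p2 : e1 *m p2 = p2 by exact: inv_mul_halve.
have wp1 : w *m p1 = p1 by exact: inv_mul_halve.
have p34 : p3 *m p4 = p4 by exact: mul_halve.
have p23 : p2 *m p3 = p3 by exact: mul_halve.
have p12 : p1 *m p2 = p2 by exact: mul_halve.
have e2p4 : e2 *m p4 = p4 by rewrite -p34 mulmxA e2p3.
have e1p3 : e1 *m p3 = p3 by rewrite -p23 mulmxA e1p2.
have e1p4 : e1 *m p4 = p4 by rewrite -p34 mulmxA e1p3.
have wp2 : w *m p2 = p2 by rewrite -p12 mulmxA wp1.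
have wp3 : w *m p3 = p3 by rewrite -p23 mulmxA wp2.
have wp4 : w *m p4 = p4 by rewrite -p34 mulmxA wp3.
have H l : indices 8 l -> X *m mono l = mono l *m X ->
    spread X *m mono l = mono l *m spread X.
  move=> l8 Xl; have dc k Y : (0 < k <= 8)%N -> Y *m mono l = mono l *m Y ->
      dbl (J k) Y *m mono l = mono l *m dbl (J k) Y.
    move=> k8 Yl; have [s|s] := boolP (sign1 k l).
      by apply: dbl_commute_anti; rewrite ?J_tr// J_mono_anti// opprK.
    by apply: dbl_commute_comm; rewrite ?J_tr// J_mono_com.
  by rewrite /spread; do 3![apply: (dc) => //].
have dj k j Y : (0 < k <= 8)%N -> (0 < j <= 8)%N -> k != j ->
    Y *m J j = J j *m Y -> dbl (J k) Y *m J j = J j *m dbl (J k) Y.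
  move=> k8 j8 kj Yj; apply: dbl_commute_anti; rewrite ?J_tr//.
  by rewrite J_anti// eq_sym.
apply: commutes_generators; try by apply: H => //; exact: corner4_com.
- by rewrite /spread; do 2![apply: (dj) => //]; exact: dbl_commute.
- by rewrite /spread; apply: dj => //; exact: dbl_commute.
- by rewrite /spread; exact: dbl_commute.
Qed.

End CliffordTower.

(** * The linear bijection of the eighth stage with the group *)

Section Periodicity.
Context {R : realType} {N q : nat} (J : nat -> 'M[R]_N).
Hypothesis J_sq : forall i, (0 < i <= 8)%N -> J i *m J i = - 1%:M.
Hypothesis J_anti : forall i j, (0 < i <= 8)%N -> (0 < j <= 8)%N -> i != j ->
  J i *m J j = - (J j *m J i).
Hypothesis J_tr : forall i, (0 < i <= 8)%N -> (J i)^T = - J i.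
Variable F : 'M[R]_(N, q).
Hypotheses (FtF : F^T *m F = 1%:M) (FFt : F *m F^T = tower4 J).
Implicit Types (X Y : 'M[R]_N) (a b : 'M[R]_q).

Local Notation p1 := (tower1 J).
Local Notation p4 := (tower4 J).

Definition lift_mx a := F *m a *m F^T.

Definition twist X := J 8 *m X *m (J 8)^T.

(** The restriction of [h = X J_8^-1] to the range of [p4], in the coordinates of the frame [F]. *)
Definition compress X := F^T *m (X *m (J 8)^T) *m F.

(* [X = h J_8] in the last stage satisfies [J_8 h J_8^-1 = h^T] and [J_8] swaps
   the ranges of [p1] and [1 - p1]; hence the transpose in the second summand. *)
Definition expand a :=
  (spread J (lift_mx a) + twist (spread J (lift_mx a^T))) *m J 8.

#[local] Opaque spread tower1 tower4.

Let J8t : (J 8)^T = - J 8. Proof. exact: J_tr. Qed.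
Let J8s : J 8 *m J 8 = - 1%:M. Proof. exact: J_sq. Qed.
Let J8J8t : J 8 *m (J 8)^T = 1%:M. Proof. by rewrite J8t mulmxN J8s opprK. Qed.
Let J8tJ8 : (J 8)^T *m J 8 = 1%:M. Proof. exact: mulmx1C. Qed.

Let lift_tr a : (lift_mx a)^T = lift_mx a^T.
Proof. by rewrite /lift_mx !trmx_mul trmxK mulmxA. Qed.

Let lift_mul a b : lift_mx a *m lift_mx b = lift_mx (a *m b).
Proof.
by rewrite /lift_mx -!mulmxA; do 2!congr (_ *m _); rewrite mulmxA FtF mul1mx.
Qed.

Let lift_trace a : \tr (lift_mx a) = \tr a.
Proof. by rewrite /lift_mx mxtrace_mulC mulmxA FtF mul1mx. Qed.

Let lift_drop a : F^T *m lift_mx a *m F = a.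
Proof. by rewrite /lift_mx !mulmxA FtF mul1mx -mulmxA FtF mulmx1. Qed.

Let drop_lift X : lift_mx (F^T *m X *m F) = p4 *m X *m p4.
Proof. by rewrite /lift_mx -FFt !mulmxA. Qed.

Lemma lift_mx_linear : linear lift_mx.
Proof.
by move=> c a b; rewrite /lift_mx mulmxDr mulmxDl -scalemxAr -scalemxAl.
Qed.

Let lift_commute a s t : s *m F = F *m t -> F^T *m s = t *m F^T ->
  a *m t = t *m a -> lift_mx a *m s = s *m lift_mx a.
Proof.
by move=> sF Fs at_; rewrite /lift_mx -mulmxA Fs !mulmxA sF -(mulmxA F) at_ !mulmxA.
Qed.

Let lift1 : lift_mx 1%:M = p4. Proof. by rewrite /lift_mx mulmx1 FFt. Qed.

Let lift_corner a : corner p4 (lift_mx a).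
Proof. by split; rewrite -lift1 lift_mul ?mul1mx ?mulmx1. Qed.

#[local] Opaque lift_mx.

Let p1_sandwich : p1 *m J 8 *m p1 = 0.
Proof. exact: tower1_sandwich. Qed.

Let cross X Y : corner p1 X -> corner p1 Y -> X *m J 8 *m Y = 0.
Proof.
move=> [_ XP] [PY _]; rewrite -XP -PY.
rewrite -(mulmxA X) -(mulmxA X) (mulmxA _ p1 Y) p1_sandwich.
by rewrite mul0mx mulmx0.
Qed.

Let twist_mul X Y : twist X *m twist Y = twist (X *m Y).
Proof.
rewrite /twist -!mulmxA (mulmxA _ (J 8)) J8tJ8 mul1mx.
by rewrite (mulmxA X).
Qed.

Let twist_tr X : (twist X)^T = twist X^T.
Proof. by rewrite /twist !trmx_mul trmxK mulmxA. Qed.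

Let twistK X : twist (twist X) = X.
Proof.
rewrite /twist J8t !mulmxN !mulNmx !mulmxA J8s !mulNmx mul1mx -!mulmxA J8s.
by rewrite !mulmxN mulmx1 !opprK.
Qed.

Let mul_twist X Y : corner p1 X -> corner p1 Y -> X *m twist Y = 0.
Proof. by move=> cX cY; rewrite /twist !mulmxA (cross cX cY) mul0mx. Qed.

Let twist_mulr X Y : corner p1 X -> corner p1 Y -> twist X *m Y = 0.
Proof.
move=> cX cY; rewrite /twist J8t mulmxN mulNmx -!mulmxA (mulmxA X) (cross cX cY).
by rewrite mulmx0 oppr0.
Qed.

(** [twist] carries the corner of [p1] to that of [1 - p1], so such sums multiply blockwise. *)
Let twist_sum_mul X X' Y Y' :
  corner p1 X -> corner p1 X' -> corner p1 Y -> corner p1 Y' ->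
  (X + twist X') *m (Y + twist Y') = X *m Y + twist (X' *m Y').
Proof.
move=> cX cX' cY cY'.
rewrite mulmxDr !mulmxDl (mul_twist cX cY') (twist_mulr cX' cY) addr0 add0r.
by rewrite twist_mul.
Qed.

Let p1_twist : p1 + twist p1 = 1%:M.
Proof. exact: tower1_dbl. Qed.

Let twistD X Y : twist (X + Y) = twist X + twist Y.
Proof. by rewrite /twist mulmxDr mulmxDl. Qed.

Let twistZ (c : R) X : twist (c *: X) = c *: twist X.
Proof. by rewrite /twist -scalemxAr -scalemxAl. Qed.

Let twist_trace X : \tr (twist X) = \tr X.
Proof. by rewrite /twist mxtrace_mulC mulmxA J8tJ8 mul1mx. Qed.

Let J8_mul X : J 8 *m X = twist X *m J 8.
Proof. by rewrite /twist -mulmxA J8tJ8 mulmx1. Qed.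

Let J_anti8 i : (0 < i < 8)%N -> J i *m J 8 = - (J 8 *m J i).
Proof.
move=> /andP[i0 i8]; apply: J_anti => //; first by rewrite i0 ltnW.
by rewrite ltn_eqF.
Qed.

Let twist_commute X i : (0 < i < 8)%N -> X *m J i = J i *m X ->
  twist X *m J i = J i *m twist X.
Proof.
move=> i8 XJ; have Ji := J_anti8 i8.
rewrite /twist J8t !mulmxN !mulNmx; congr (- _).
rewrite -!mulmxA (_ : J 8 *m J i = - (J i *m J 8)); last by rewrite Ji opprK.
by rewrite !mulmxN (mulmxA _ (J i) (J 8)) XJ !mulmxA Ji !mulNmx.
Qed.

Let twist_hT X : X^T = - X -> (X *m (J 8)^T)^T = twist (X *m (J 8)^T).
Proof.
move=> Xs; have JJ : (J 8)^T *m (J 8)^T = - 1%:M by rewrite J8t mulmxN mulNmx opprK.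
rewrite /twist trmx_mul trmxK Xs mulmxN -(mulmxA (J 8)) -(mulmxA X) JJ.
by rewrite !mulmxN mulmx1.
Qed.

#[local] Opaque twist.

Let core a := spread J (lift_mx a) + twist (spread J (lift_mx a^T)).

Let spr a : corner p1 (spread J (lift_mx a)).
Proof. exact/spread_corner/lift_corner. Qed.

Let expandE a : expand a = core a *m J 8. Proof. by []. Qed.

Let core_tr a : (core a)^T = core a^T.
Proof.
rewrite /core [LHS]linearD/= twist_tr.
by congr (_ + twist _); rewrite [LHS]spread_tr lift_tr.
Qed.

Let core_trE a : (core a)^T = twist (core a).
Proof.
rewrite core_tr /core trmxK twistD twistK [RHS]addrC.
reflexivity.
Qed.

Let core_trM a b : (core a)^T *m core b =
  spread J (lift_mx (a^T *m b)) + twist (spread J (lift_mx (a *m b^T))).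
Proof.
rewrite core_tr /core trmxK (twist_sum_mul (spr _) (spr _) (spr _) (spr _)).
have sm c d : spread J (lift_mx c) *m spread J (lift_mx d) =
    spread J (lift_mx (c *m d)).
  rewrite (spread_mul J_sq J_anti J_tr (lift_corner c) (lift_corner d)).
  by rewrite lift_mul.
by congr (_ + twist _); exact: sm.
Qed.

Let core_commute a i : (0 < i < 8)%N -> core a *m J i = J i *m core a.
Proof.
move=> i8; rewrite /core mulmxDl mulmxDr.
have i7 : (0 < i <= 7)%N by [].
rewrite (spread_commute J_sq J_anti J_tr (lift_corner a) i7); congr (_ + _).
apply: twist_commute => //.
exact: (spread_commute J_sq J_anti J_tr (lift_corner a^T) i7).
Qed.

Lemma expand_linear : linear expand.
Proof.
move=> c a b; rewrite /expand linearP/= !lift_mx_linear !spread_linear.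
rewrite twistD twistZ addrACA -scalerDr.
by rewrite mulmxDl -scalemxAl.
Qed.

Lemma compress_expand a : compress (expand a) = a.
Proof.
rewrite /compress expandE -(mulmxA (core a)) J8J8t mulmx1.
have F4 : F = p4 *m F by rewrite -FFt -mulmxA FtF mulmx1.
have F4t : F^T = F^T *m p4 by rewrite -FFt mulmxA FtF mul1mx.
have -> : F^T *m core a *m F = F^T *m (p4 *m core a *m p4) *m F.
  by rewrite -!mulmxA -F4 !mulmxA -F4t.
(* The twisted summand lives on the range of [1 - p1], which [p4] kills. *)
rewrite /core mulmxDr (mul_twist _ (spr _)); last exact: tower4_corner.
rewrite addr0 (spread_compress J_sq J_anti J_tr (lift_corner a)).
exact: lift_drop.
Qed.

Lemma clifford_commute1 X i :
  (forall i, (0 < i < 8)%N -> X *m J i = - (J i *m X)) -> (0 < i <= 7)%N ->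
  X *m (J 8)^T *m J i = J i *m (X *m (J 8)^T).
Proof.
move=> XJ i7; rewrite J8t mulmxN mulNmx mulmxN -mulmxA.
have -> : J 8 *m J i = - (J i *m J 8) by rewrite (J_anti8 i7) opprK.
by rewrite mulmxN (mulmxA X (J i)) XJ// mulNmx opprK -mulmxA.
Qed.

(** [p4] is a polynomial in [J 1, ..., J 7]. *)
Lemma commute_tower4 Y : (forall i, (0 < i <= 7)%N -> Y *m J i = J i *m Y) ->
  Y *m p4 = p4 *m Y.
Proof.
move=> YJ; apply: tower4_commute; apply: commutes_mono => i;
by rewrite !inE => il; apply: YJ; move: i il; do 8?[case=> //].
Qed.

Lemma clifford_commute X :
  (forall i, (0 < i < 8)%N -> X *m J i = - (J i *m X)) ->
  X *m (J 8)^T *m p4 = p4 *m (X *m (J 8)^T).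
Proof. by move=> XJ; apply: commute_tower4 => i; exact: clifford_commute1. Qed.

(** The conditions on [X] are linear, so the identity applies to tangent vectors of the stage as
    well as to its points. *)
Lemma expand_compress X : X^T = - X ->
  (forall i, (0 < i < 8)%N -> X *m J i = - (J i *m X)) -> expand (compress X) = X.
Proof.
move=> Xs XJ; pose h := X *m (J 8)^T.
have hT : h^T = twist h by exact: twist_hT.
have hJ i : (0 < i <= 7)%N -> h *m J i = J i *m h by exact: clifford_commute1.
have hTJ i : (0 < i <= 7)%N -> h^T *m J i = J i *m h^T.
  move=> i7; have /andP[i0 i7'] := i7.
  have Jt : (J i)^T = - J i by apply: J_tr; rewrite i0 leqW.
  by apply: oppr_inj; rewrite -mulmxN -mulNmx -Jt -!trmx_mul hJ.
have p4p4 : p4 *m p4 = p4 by rewrite -lift1 lift_mul mul1mx.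
have lh : lift_mx (compress X) = h *m p4.
  by rewrite /compress -/h drop_lift -(commute_tower4 hJ) -mulmxA p4p4.
have lhT : lift_mx (compress X)^T = h^T *m p4.
  by rewrite -lift_tr lh trmx_mul -lift1 lift_tr trmx1 lift1 -(commute_tower4 hTJ).
rewrite /expand lh lhT !(spread_mull J_tr)//.
rewrite (spread_tower4 J_sq J_anti J_tr).
(* The two halves then recombine as [h (p1 + twist p1) = h]. *)
have -> : twist (h^T *m p1) = h *m twist p1.
  rewrite -twist_mul; congr (_ *m _).
  by rewrite hT; exact: twistK.
rewrite -mulmxDr p1_twist mulmx1 /h -mulmxA J8tJ8 mulmx1.
by [].
Qed.

(** [spread] makes eight copies on the range of [p1], and the twisted summand eight more on its
    complement. *)
Lemma expand_trace a b : \tr ((expand a)^T *m expand b) = \tr (a^T *m b) *+ 16.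
Proof.
rewrite (expandE a) (expandE b) trmx_mul mxtrace_mulC -mulmxA (mulmxA (J 8)).
rewrite J8J8t mul1mx mxtrace_mulC core_trM mxtraceD.
have st c : \tr (spread J (lift_mx c)) = \tr c *+ 8.
  by rewrite [LHS](spread_trace J_sq J_tr) lift_trace.
rewrite twist_trace; transitivity (\tr (a^T *m b) *+ 8 + \tr (a *m b^T) *+ 8).
  by congr (_ + _); exact: st.
rewrite -[X in _ + X *+ 8]mxtrace_tr trmx_mul trmxK [X in _ + X *+ 8]mxtrace_mulC.
by rewrite -mulrnDr.
Qed.

(** [S] and [T] are the structures before and after compression; [F] intertwines them, so membership
    in U or Sp transfers both ways. *)
Variables (S : set 'M[R]_N) (T : set 'M[R]_q).
Hypothesis S_tr : forall s, S s -> s^T = s \/ s^T = - s.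
Hypothesis SJ : forall s i, S s -> (0 < i <= 8)%N -> s *m J i = J i *m s.
Hypothesis ST : forall s, S s ->
  exists t, [/\ T t, s *m F = F *m t & F^T *m s = t *m F^T].
Hypothesis TS : forall t, T t ->
  exists s, [/\ S s, s *m F = F *m t & F^T *m s = t *m F^T].

Lemma expand_stage a : a *m a^T = 1%:M -> commutes T a -> stage S J 8 (expand a).
Proof.
move=> aa aT; have aa' := mulmx1C aa.
have cc' : (core a)^T *m core a = 1%:M.
  by rewrite core_trM aa aa' lift1 (spread_tower4 J_sq J_anti J_tr).
have cc := mulmx1C cc'.
have J8c : J 8 *m core a = (core a)^T *m J 8.
  by rewrite core_trE J8_mul.
split; rewrite expandE.
- by rewrite trmx_mul -mulmxA (mulmxA (J 8)) J8J8t mul1mx.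
- have lS b : commutes T b -> commutes S (lift_mx b).
    move=> bT s Ss; have [t [Tt sF Fs]] := ST Ss.
    exact: (lift_commute sF Fs (bT _ Tt)).
  have spS Y : commutes S Y -> commutes S (spread J Y).
    by move=> YS s Ss; apply: spread_commute_comm; rewrite ?SJ ?YS.
  have JS : commutes S (J 8) by move=> s Ss; rewrite SJ.
  have J8tS : commutes S (J 8)^T by exact: commutes_tr.
  have aTt : commutes S (spread J (lift_mx a^T)).
    by rewrite -lift_tr -spread_tr; apply/(commutes_tr S_tr)/spS/lS.
  apply: commutes_mul => //; apply: commutesD; first exact/spS/lS.
  (* [twist] is opaque here, so its formula is recovered from [J8_mul]. *)
  have -> X : twist X = J 8 *m X *m (J 8)^T by rewrite J8_mul -mulmxA J8J8t mulmx1.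
  exact: commutes_mul (commutes_mul JS aTt) J8tS.
- move=> _; rewrite -mulmxA (mulmxA (J 8)) J8c -mulmxA J8s mulmxN mulmx1.
  by rewrite mulmxN cc.
- move=> i i8; rewrite -mulmxA.
  have -> : J 8 *m J i = - (J i *m J 8) by rewrite (J_anti8 i8) opprK.
  by rewrite mulmxN (mulmxA (core a)) (core_commute a i8) -mulmxA.
Qed.

Lemma compress_commute X s t : s *m F = F *m t -> F^T *m s = t *m F^T ->
  s *m J 8 = J 8 *m s -> X *m s = s *m X -> compress X *m t = t *m compress X.
Proof.
move=> sF Fs sJ Xs; have Js : (J 8)^T *m s = s *m (J 8)^T.
  by rewrite J8t mulNmx mulmxN sJ.
have : X *m (J 8)^T *m s = s *m (X *m (J 8)^T) by rewrite -mulmxA Js mulmxA Xs mulmxA.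
rewrite /compress; move: (X *m _) => h hs.
by rewrite -(mulmxA _ F) -sF mulmxA -(mulmxA _ h) hs mulmxA Fs -!mulmxA.
Qed.

(** [h] is orthogonal and commutes with [p4], so it restricts to an orthogonal map of the range of
    [p4]. *)
Lemma compress_orth X : stage S J 8 X ->
  compress X *m (compress X)^T = 1%:M /\ commutes T (compress X).
Proof.
move=> sX; have [XX XS _ XJ] := sX.
have Xs : X^T = - X by exact: stage_skew sX.
pose h := X *m (J 8)^T.
have hh : h *m h^T = 1%:M.
  by rewrite /h trmx_mul trmxK -mulmxA (mulmxA _ (J 8)) J8tJ8 mul1mx.
have hp4 : h *m p4 = p4 *m h by exact: clifford_commute.
split.
  have E Z : F^T *m Z *m F *m (F^T *m Z *m F)^T =
      F^T *m (Z *m (F *m F^T) *m Z^T) *m F.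
    by rewrite !trmx_mul trmxK !mulmxA.
  rewrite /compress -/h E FFt hp4 -(mulmxA p4) hh mulmx1 -FFt mulmxA FtF mul1mx.
  exact: FtF.
move=> t Tt; have [s [Ss sF Fs]] := TS Tt.
by apply: (compress_commute sF Fs); [exact: SJ|exact: XS].
Qed.

End Periodicity.

(** * Orthonormal frames *)

Section Frames.
Context {R : realType} {N : nat}.

(** The trace stands for the rank: splitting off a unit vector of the range lowers it by one. *)
Lemma proj_frame n (p : 'M[R]_N) : proj p -> \tr p = n%:R ->
  exists F : 'M[R]_(N, n), F^T *m F = 1%:M /\ F *m F^T = p.
Proof.
elim: n p => [|n IH] p [pT p2] trp.
  have -> : p = 0 by apply: trace_mulmx_tr_eq0; rewrite pT p2 trp.
  by exists 0; rewrite mulmx0 mul0mx; split=> //; apply/matrixP => -[].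
have p0 : p != 0.
  by apply/eqP => p0; move/eqP: trp; rewrite p0 mxtrace0 eq_sym pnatr_eq0.
have [v v0 vp] : exists2 v : 'rV[R]_N, v != 0 & v *m p = v.
  have [i pi] : exists i, row i p != 0.
    apply/existsP; rewrite -negb_forall; apply: contra p0 => /forallP pi.
    by apply/eqP/row_matrixP => i; rewrite row0; exact/eqP.
  by exists (row i p) => //; rewrite -row_mul p2.
have [a a0 ee] := row_normalize v0.
move: ee (scalemxAl a v p); rewrite vp; move: (a *: v) => e ee ep.
have pe : p *m e^T = e^T by rewrite -{1}pT -trmx_mul -ep.
have [||F [FtF FFt]] := IH (p - e^T *m e).
- split; first by rewrite linearB/= trmx_mul trmxK pT.
  rewrite mulmxBr !mulmxBl p2 mulmxA pe -(mulmxA e^T e p) -ep.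
  by rewrite mulmxA -(mulmxA e^T e) ee mulmx1 subrr subr0.
- by rewrite linearB/= trp mxtrace_mulC ee mxtrace1 -natrB// subn1.
have eF : e *m F = 0.
  apply: mulmx_tr_eq0; rewrite trmx_mul mulmxA -(mulmxA e) FFt.
  by rewrite mulmxBr mulmxA ee mul1mx -ep subrr mul0mx.
have Fe : F^T *m e^T = 0 by rewrite -trmx_mul eF trmx0.
(* [1 + n] is convertible to [n.+1], so [G] has the required size. *)
pose G : 'M[R]_(N, 1 + n) := row_mx e^T F.
have GtG : G^T *m G = 1%:M.
  rewrite /G tr_row_mx trmxK mul_col_row ee eF Fe FtF.
  by rewrite -(@scalar_mx_block _ 1 n).
have GGt : G *m G^T = p by rewrite /G tr_row_mx trmxK mul_row_col FFt addrC subrK.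
by exists G.
Qed.

End Frames.

(** * Real matrices inside the realified symplectic group *)

Section Duplication.
Context {R : realType}.

Definition dup p q (A : 'M[R]_(p, q)) : 'M[R]_(p + p, q + q) := block_mx A 0 0 A.

Lemma dup_mul p q s (A : 'M[R]_(p, q)) (B : 'M[R]_(q, s)) :
  dup (A *m B) = dup A *m dup B.
Proof.
by rewrite /dup mulmx_block !(mulmx0, mul0mx, addr0, add0r).
Qed.

Lemma dupD p q (A B : 'M[R]_(p, q)) : dup (A + B) = dup A + dup B.
Proof. by rewrite /dup add_block_mx addr0. Qed.

Lemma dupZ p q c (A : 'M[R]_(p, q)) : dup (c *: A) = c *: dup A.
Proof. by rewrite /dup scale_block_mx scaler0. Qed.

Lemma dupN p q (A : 'M[R]_(p, q)) : dup (- A) = - dup A.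
Proof. by rewrite /dup opp_block_mx oppr0. Qed.

Lemma dup1 p : dup 1%:M = 1%:M :> 'M[R]_(p + p).
Proof. by rewrite /dup -scalar_mx_block. Qed.

Lemma dup_tr p q (A : 'M[R]_(p, q)) : (dup A)^T = dup A^T.
Proof. by rewrite /dup tr_block_mx !trmx0. Qed.

Lemma imx_dup p q (A : 'M[R]_(p, q)) : imx *m dup A = dup A *m imx.
Proof.
rewrite /dup !imxE !mulmx_block !(mulmx0, mul0mx, mulmx1, mul1mx, addr0, add0r).
by rewrite mulmxN mulNmx mulmx1 mul1mx.
Qed.

(** One duplication comes from [so_incl], the other from realification. *)
Definition dup2 p q (A : 'M[R]_(p, q)) := dup (dup A).

Lemma dup2_mul p q s (A : 'M[R]_(p, q)) (B : 'M[R]_(q, s)) :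
  dup2 (A *m B) = dup2 A *m dup2 B.
Proof. by rewrite /dup2 !dup_mul. Qed.

Lemma dup2D p q (A B : 'M[R]_(p, q)) : dup2 (A + B) = dup2 A + dup2 B.
Proof. by rewrite /dup2 !dupD. Qed.

Lemma dup2Z p q c (A : 'M[R]_(p, q)) : dup2 (c *: A) = c *: dup2 A.
Proof. by rewrite /dup2 !dupZ. Qed.

Lemma dup2N p q (A : 'M[R]_(p, q)) : dup2 (- A) = - dup2 A.
Proof. by rewrite /dup2 !dupN. Qed.

Lemma dup2_1 p : dup2 1%:M = 1%:M :> 'M[R]_(p + p + (p + p)).
Proof. by rewrite /dup2 !dup1. Qed.

Lemma dup2_tr p q (A : 'M[R]_(p, q)) : (dup2 A)^T = dup2 A^T.
Proof. by rewrite /dup2 !dup_tr. Qed.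

Lemma jmx_dup2 p q (A : 'M[R]_(p, q)) : jmx *m dup2 A = dup2 A *m jmx.
Proof.
have e : @imx R p *m dup A = dup A *m imx by exact: imx_dup.
rewrite /dup2; move: (dup A) e => B e; rewrite /jmx /dup.
rewrite (mulmx_block imx) (mulmx_block B) !(mulmx0, mul0mx, addr0, add0r) e.
by rewrite mulNmx mulmxN e.
Qed.

Lemma dmx_dup2 p q (A : 'M[R]_(p, q)) : dmx *m dup2 A = dup2 A *m dmx.
Proof.
pose d s : 'M[R]_(s + s) := block_mx 1%:M 0 0 (- 1%:M).
have dE s : dmx = dup (d s) by [].
rewrite /dup2 !dE -!dup_mul; congr dup.
rewrite /dup /d !mulmx_block !(mulmx0, mul0mx, mulmx1, mul1mx, addr0, add0r).
by rewrite mulmxN mulNmx mulmx1 mul1mx.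
Qed.

(** A structure acts only on the copies made by [dup2], so its namesake of the other size
    corresponds to it, even for rectangular [A]. *)
Lemma structure_dup2 b p q (s : 'M[R]_(p + p + (p + p))) :
  structure imx jmx dmx b s ->
  exists2 t : 'M[R]_(q + q + (q + q)), structure imx jmx dmx b t &
    forall A : 'M[R]_(p, q), s *m dup2 A = dup2 A *m t /\
                             (dup2 A)^T *m s = t *m (dup2 A)^T.
Proof.
move=> [->|->|[bb ->]].
- exists imx; first by constructor 1.
  by move=> A; rewrite dup2_tr /dup2 !imx_dup.
- exists jmx; first by constructor 2.
  by move=> A; rewrite dup2_tr !jmx_dup2.
- exists dmx; first by constructor 3.
  by move=> A; rewrite dup2_tr !dmx_dup2.
Qed.

Lemma dup2_structure b p q (t : 'M[R]_(q + q + (q + q))) :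
  structure imx jmx dmx b t ->
  exists2 s : 'M[R]_(p + p + (p + p)), structure imx jmx dmx b s &
    forall A : 'M[R]_(p, q), s *m dup2 A = dup2 A *m t /\
                             (dup2 A)^T *m s = t *m (dup2 A)^T.
Proof.
move=> [->|->|[bb ->]].
- exists imx; first by constructor 1.
  by move=> A; rewrite dup2_tr /dup2 !imx_dup.
- exists jmx; first by constructor 2.
  by move=> A; rewrite dup2_tr !jmx_dup2.
- exists dmx; first by constructor 3.
  by move=> A; rewrite dup2_tr !dmx_dup2.
Qed.

Lemma structure_commute_dup2 b p (s : 'M[R]_(p + p + (p + p))) (A : 'M[R]_p) :
  structure imx jmx dmx b s -> s *m dup2 A = dup2 A *m s.
Proof. by move=> [->|->|[_ ->]]; rewrite ?imx_dup ?jmx_dup2 ?dmx_dup2. Qed.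

Lemma realmx_so_incl r (A : 'M[R]_r) : realmx (so_incl A) = dup2 A.
Proof. by rewrite /realmx /so_incl /= oppr0. Qed.

Lemma dup2_mono r (J : nat -> 'M[R]_r) l :
  mono (fun k => dup2 (J k)) l = dup2 (mono J l).
Proof.
by elim: l => [|i l IH] /=; rewrite ?dup2_1// -/(mono _ l) IH dup2_mul.
Qed.

Lemma dup2_halve r (p e : 'M[R]_r) : dup2 (halve p e) = halve (dup2 p) (dup2 e).
Proof. by rewrite /halve dup2Z dup2_mul dup2D dup2_1. Qed.

(** Lets a frame of [tower4 J] be chosen before duplication, so that the duplicated frame
    intertwines the structures. *)
Lemma dup2_tower4 r (J : nat -> 'M[R]_r) :
  tower4 (fun k => dup2 (J k)) = dup2 (tower4 J).
Proof.
by rewrite /tower4 /tower3 /tower2 /tower1 !dup2_mono -dup2_1 -!dup2_halve.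
Qed.

End Duplication.

(** * Smoothness of linear maps *)

Section LinearMaps.
Context {R : realType} {V W : normedModType R}.

Lemma Ck_cst k (w : W) : Ck k (fun _ : V => w).
Proof.
elim: k w => [|k IH] w /=; first exact: cst_continuous.
split=> [x|v]; first exact: differentiable_cst.
have -> : (fun x : V => 'D_v (fun _ => w) x) = fun _ => 0.
  by apply/funext => x; exact: derive_cst.
exact: IH.
Qed.

Lemma linear_derive (f : V -> W) x v : linear f -> continuous f -> 'D_v f x = f v.
Proof.
move=> fl fc; pose fL := GRing.isLinear.Build _ _ _ _ _ fl.
pose g : {linear V -> W} := HB.pack f fL.
have gd : differentiable g x by exact: linear_differentiable.
by rewrite -[f]/(g : V -> W) deriveE// (@diff_lin _ _ _ g).
Qed.

Lemma linear_smooth (f : V -> W) : linear f -> continuous f -> smooth f.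
Proof.
move=> fl fc [|k] //=; split=> [x|v].
  pose fL := GRing.isLinear.Build _ _ _ _ _ fl.
  pose g : {linear V -> W} := HB.pack f fL.
  by apply: (@linear_differentiable _ _ _ g).
have -> : (fun x => 'D_v f x) = fun _ => f v.
  by apply/funext => x; exact: linear_derive.
exact: Ck_cst.
Qed.

End LinearMaps.

(** * Clifford relations between the base points *)

Section BasePoints.
Context {R : realType} {n : nat}.
Local Notation r := (16 * n)%N.
Variables (P : nat -> set 'M[R]_r) (J : nat -> 'M[R]_r).
Hypothesis bp : base_points P J.

Lemma components_sub (T : topologicalType) (A C : set T) x :
  connected_component A x = C -> C `<=` A.
Proof. by move=> <-; exact: connected_component_sub. Qed.

(** The [P k] decrease from [k = 1] on, so [J j] lies in [P i.+1], whose elements anticommute with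
    [J i]. *)
Lemma base_points_anti i j : (0 < i)%N -> (i < j <= 8)%N ->
  J j *m J i = - (J i *m J j).
Proof.
have [_ _ top PJ] := bp; move=> i0 /andP[ij j8].
have sub k : (0 < k <= 7)%N ->
    P k.+1 `<=` [set A | P k A /\ A *m J k = - (J k *m A)].
  by move=> k7; have [[x _ /components_sub]] := top k k7.
have Pi k : (i.+1 + k <= 8)%N -> P (i.+1 + k)%N `<=` P i.+1.
  elim: k => [|k IH] ik; first by rewrite addn0.
  rewrite addnS in ik * => A PA.
  have b : (0 < i.+1 + k <= 7)%N by lia.
  by have [PA' _] := sub _ b A PA; apply: IH PA'; exact: ltnW.
have PJj : P i.+1 (J j).
  by apply: (Pi (j - i.+1)%N); rewrite subnKC//; exact: PJ.
have i7 : (0 < i <= 7)%N by lia.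
by have [_] := sub _ i7 _ PJj.
Qed.

Lemma base_points_sq i : (0 < i <= 8)%N ->
  J i *m (J i)^T = 1%:M /\ J i *m J i = - 1%:M.
Proof.
have [_ P1 top PJ] := bp; move=> /andP[i0 i8].
have sub k : (0 < k <= 7)%N -> P k.+1 `<=` P k.
  by move=> k7 A; have [[x _ /components_sub s] _] := top k k7; move=> /s[].
have {}sub k : (k.+1 <= 8)%N -> P k.+1 `<=` P 1%N.
  elim: k => [_ A //|k IH k8 A PA]; apply: IH; first exact: ltnW.
  exact: sub PA.
have : P 1%N (J i) by case: i i0 i8 => // i _ i8; apply: (sub i) => //; exact: PJ.
by have [x _ /components_sub s] := P1; move=> /s[[]].
Qed.

End BasePoints.

(** * The isometry with the symplectic group *)

Section Identification.
Context {R : realType} {r n : nat} (J : nat -> 'M[R]_r) (F : 'M[R]_(r, n)).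
Hypothesis J_sq : forall i, (0 < i <= 8)%N -> J i *m J i = - 1%:M.
Hypothesis J_anti : forall i j, (0 < i <= 8)%N -> (0 < j <= 8)%N -> i != j ->
  J i *m J j = - (J j *m J i).
Hypothesis J_tr : forall i, (0 < i <= 8)%N -> (J i)^T = - J i.
Hypotheses (FtF : F^T *m F = 1%:M) (FFt : F *m F^T = tower4 J).

Let J2 k := dup2 (J k).

Let J2_sq i : (0 < i <= 8)%N -> J2 i *m J2 i = - 1%:M.
Proof. by move=> i8; rewrite /J2 -dup2_mul J_sq// dup2N dup2_1. Qed.

Let J2_anti i j : (0 < i <= 8)%N -> (0 < j <= 8)%N -> i != j ->
  J2 i *m J2 j = - (J2 j *m J2 i).
Proof. by move=> i8 j8 ij; rewrite /J2 -!dup2_mul J_anti// dup2N. Qed.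

Let J2_tr i : (0 < i <= 8)%N -> (J2 i)^T = - J2 i.
Proof. by move=> i8; rewrite /J2 dup2_tr J_tr// dup2N. Qed.

Let F2tF2 : (dup2 F)^T *m dup2 F = 1%:M.
Proof. by rewrite dup2_tr -dup2_mul FtF dup2_1. Qed.

Let F2F2t : dup2 F *m (dup2 F)^T = tower4 J2.
Proof. by rewrite dup2_tr -dup2_mul FFt /J2 dup2_tower4. Qed.

Local Notation str b p := (structure (@imx R (p + p)) jmx dmx b).

Definition bott_map (x : cmat R (r + r)) : cmat R (n + n) :=
  unreal (compress J2 (dup2 F) (realmx x)).

Definition bott_inv (y : cmat R (n + n)) : cmat R (r + r) :=
  unreal (expand J2 (dup2 F) (realmx y)).

Lemma realmx_bott_map x : realmx (bott_map x) = compress J2 (dup2 F) (realmx x).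
Proof.
apply: unrealK; apply: (@compress_commute _ _ _ _ J2_tr _ _ imx).
- by rewrite /dup2 imx_dup.
- by rewrite dup2_tr /dup2 imx_dup.
- by rewrite /J2 /dup2 imx_dup.
- exact: realmx_imx.
Qed.

Lemma bott_map_linear : linear bott_map.
Proof.
move=> a x y; rewrite /bott_map -unreal_linear; congr unreal.
rewrite realmx_linear /compress mulmxDl mulmxDr mulmxDl -scalemxAl -scalemxAr.
by rewrite -scalemxAl.
Qed.

Lemma bott_inv_linear : linear bott_inv.
Proof.
move=> a x y; rewrite /bott_inv -unreal_linear; congr unreal.
by rewrite realmx_linear expand_linear.
Qed.

Local Notation stage8 b := (realmx @^-1` stage (str b r) J2 8).

Let expand_stage8 b y : gmx b (realmx y) ->
  stage (str b r) J2 8 (expand J2 (dup2 F) (realmx y)).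
Proof.
move=> [yy yS].
apply: (@expand_stage _ _ _ _ J2_sq J2_anti J2_tr _ F2tF2 F2F2t _ (str b n)) => //.
- exact: block_structure_tr.
- by move=> s i Ss _; exact: structure_commute_dup2 Ss.
- move=> s Ss; have [t Tt tE] := @structure_dup2 _ _ _ n _ Ss.
  by exists t; have [] := tE F.
Qed.

Lemma realmx_bott_inv b y : gmx b (realmx y) ->
  realmx (bott_inv y) = expand J2 (dup2 F) (realmx y).
Proof.
move=> /expand_stage8[_ yS _ _]; apply: unrealK; apply: yS; constructor 1.
by [].
Qed.

Lemma bott_inv_stage b y : gmx b (realmx y) -> stage8 b (bott_inv y).
Proof. by move=> yG; rewrite /= (realmx_bott_inv yG); exact: expand_stage8. Qed.

Lemma bott_map_gmx b x : stage8 b x -> gmx b (realmx (bott_map x)).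
Proof.
move=> sx; rewrite realmx_bott_map.
apply: (@compress_orth _ _ _ _ J2_sq J2_anti J2_tr _ F2tF2 F2F2t (str b r)).
- by move=> s i Ss _; exact: structure_commute_dup2 Ss.
- move=> t Tt; have [s Ss sE] := @dup2_structure _ _ r _ _ Tt.
  by exists s; have [] := sE F.
- exact: sx.
Qed.

Lemma bott_invK b y : gmx b (realmx y) -> bott_map (bott_inv y) = y.
Proof.
move=> yG; rewrite /bott_map (realmx_bott_inv yG).
by rewrite (compress_expand J2_sq J2_anti J2_tr F2tF2 F2F2t) realmxK.
Qed.

Lemma expand_bott_map (x : cmat R (r + r)) : (realmx x)^T = - realmx x ->
  (forall i, (0 < i < 8)%N -> realmx x *m J2 i = - (J2 i *m realmx x)) ->
  expand J2 (dup2 F) (realmx (bott_map x)) = realmx x.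
Proof.
move=> xs xJ; rewrite realmx_bott_map.
exact: (expand_compress J2_sq J2_anti J2_tr F2tF2 F2F2t).
Qed.

Lemma bott_mapK b x : stage8 b x -> bott_inv (bott_map x) = x.
Proof.
move=> sx; have [_ _ _ xJ] := sx.
rewrite /bott_inv expand_bott_map ?realmxK//.
exact: stage_skew sx.
Qed.

Lemma bott_map_dot (u v : cmat R (r + r)) :
  (realmx u)^T = - realmx u ->
  (forall i, (0 < i < 8)%N -> realmx u *m J2 i = - (J2 i *m realmx u)) ->
  (realmx v)^T = - realmx v ->
  (forall i, (0 < i < 8)%N -> realmx v *m J2 i = - (J2 i *m realmx v)) ->
  16 * dot (bott_map u) (bott_map v) = dot u v.
Proof.
move=> us uJ vs vJ; rewrite !dot_realmx.
rewrite -[in RHS](expand_bott_map us uJ) -[in RHS](expand_bott_map vs vJ).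
rewrite (expand_trace J2_sq J2_anti J2_tr F2tF2 F2F2t).
by rewrite mulrA mulr_natl.
Qed.

Lemma stage8_connected b : connected (stage8 b).
Proof.
have -> : stage8 b = bott_inv @` (realmx @^-1` gmx b).
  apply/seteqP; split=> [x sx|_ [y yG <-]]; last exact: bott_inv_stage.
  by exists (bott_map x); [exact: bott_map_gmx|exact: bott_mapK sx].
apply: connected_continuous_connected; first exact: preimage_gmx_connected.
exact/continuous_subspaceT/cmat_linear_continuous/bott_inv_linear.
Qed.

(** Skewness and anticommutation are linear relations, so differentiating a curve passes them on to
    its velocity. *)
Lemma stage8_tangent b M (x v : cmat R (r + r)) :
  M `<=` stage8 b -> tangent M x v ->
  (realmx v)^T = - realmx v /\
  forall i, (0 < i < 8)%N -> realmx v *m J2 i = - (J2 i *m realmx v).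
Proof.
move=> Ms [c [Mc _]] /(linear_curve_is_derive realmx_linear) cv.
split=> [|i i8].
  apply: (@eq_is_derive _ _ (fun t => (realmx (c t))^T) (fun t => - realmx (c t)) 0).
  - by move=> t; exact: stage_skew (Ms _ (Mc t)).
  - exact: is_derive_trmx.
rewrite -mulNmx.
apply: (@eq_is_derive _ _ (fun t => realmx (c t) *m J2 i)
  (fun t => - J2 i *m realmx (c t)) 0).
- by move=> t; have [_ _ _ ->] := Ms _ (Mc t); rewrite ?mulNmx.
- exact: is_derive_mulmxr.
- exact: is_derive_mulmxl.
Qed.

Lemma bott_map_isometry :
  riemannian_isometry dot (fun u v : cmat R (n + n) => 16 * dot u v)
    (stage8 false) (Sp n) bott_map.
Proof.
have fc := cmat_linear_continuous bott_map_linear.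
have gc := cmat_linear_continuous bott_inv_linear.
rewrite SpE; split.
- exact: linear_smooth bott_map_linear fc.
- exists bott_inv; split.
  + exact: linear_smooth bott_inv_linear gc.
  + by move=> y; exact: bott_inv_stage.
  + by move=> x; exact: bott_mapK.
  + by move=> y; exact: bott_invK.
- by move=> x; exact: bott_map_gmx.
- move=> x u v _ tu tv; rewrite !linear_derive//; try exact: bott_map_linear.
  have [us uJ] := stage8_tangent (fun _ h => h) tu.
  have [vs vJ] := stage8_tangent (fun _ h => h) tv.
  exact: bott_map_dot.
Qed.

Lemma bott_map_U : bott_map @` stage8 true = U n.
Proof.
rewrite UE; apply/seteqP; split=> [_ [x sx <-]|y yG]; first exact: bott_map_gmx.
by exists (bott_inv y); [exact: bott_inv_stage|exact: bott_invK yG].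
Qed.

End Identification.

Theorem theorem4p3 (R : realType) (n : nat) (n_ge1 : (1 <= n)%N)
    (P : nat -> set 'M[R]_(16 * n)) (J : nat -> 'M[R]_(16 * n))
    (Pt Pb : nat -> set (cmat R (16 * n + 16 * n))) :
  base_points P J -> U_Bott_chain J Pt -> Sp_Bott_chain J Pb ->
  Pt 8%N `<=` Pb 8%N /\
  exists c : R, 0 < c /\
  exists chi : cmat R (16 * n + 16 * n) -> cmat R (n + n),
    riemannian_isometry dot (fun u v : cmat R (n + n) => c * dot u v)
      (Pb 8%N) (Sp n) chi /\
    chi @` Pt 8%N = U n.
Proof.
move=> bp [Pt0 Pt_top] [Pb0 Pb_s].
have J_sq i : (0 < i <= 8)%N -> J i *m J i = - 1%:M.
  by move=> /(base_points_sq bp)[].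
have J_tr i : (0 < i <= 8)%N -> (J i)^T = - J i.
  move=> /(base_points_sq bp)[JJ J2].
  by rewrite -[(J i)^T]mul1mx -[1%:M]opprK -J2 mulNmx -mulmxA JJ mulmx1.
have J_anti i j : (0 < i <= 8)%N -> (0 < j <= 8)%N -> i != j ->
    J i *m J j = - (J j *m J i).
  move=> /andP[i0 i8] /andP[j0 j8]; rewrite neq_ltn => /orP[ij|ji].
    by rewrite (base_points_anti bp i0 (j := j)) ?opprK// ij.
  by rewrite (base_points_anti bp j0 (j := i))// ji.
(* The projection [tower4 J] has trace [16 n / 16 = n]. *)
have [F [FtF FFt]] : exists F : 'M[R]_(16 * n, n),
    F^T *m F = 1%:M /\ F *m F^T = tower4 J.
  apply: proj_frame; first exact: tower4_proj.
  by rewrite tower4_trace// natrM mulrC mulKf ?pnatr_eq0.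
pose Jc k : cmat R (16 * n + 16 * n) := so_incl (J k).
have rJ : (fun k => realmx (Jc k)) = fun k => dup2 (J k).
  by apply/funext => k; exact: realmx_so_incl.
have J0 : realmx (Jc 0%N) = 1%:M.
  by have [[_ J0] _ _ _] := bp; rewrite realmx_so_incl J0 dup2_1.
have J_skew i : (0 < i < 8)%N -> (realmx (Jc i))^T = - realmx (Jc i).
  by move=> /andP[i0 i8]; rewrite realmx_so_incl dup2_tr J_tr ?dup2N// i0 ltnW.
pose stage8 b := realmx @^-1` stage (structure imx jmx dmx b)
  (fun k => dup2 (J k)) 8 : set (cmat R (16 * n + 16 * n)).
have chain b (M : nat -> set (cmat R (16 * n + 16 * n))) :
    M 0%N = realmx @^-1` gmx b ->
    (forall k, (k <= 7)%N -> centriole dot (M k) (Jc k) (- Jc k) (M k.+1)) ->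
    M 8 = stage8 b.
  move=> M0 cen.
  have Simx : structure imx jmx dmx b (@imx R (16 * n + 16 * n)) by constructor 1.
  have [||//|sat /(_ isT) M8] :=
    @chain_saturated _ _ _ Jc (@block_structure_tr _ _ b) Simx J0 M 8.
  - by rewrite M0 /stage_set stage0_gmx.
  - exact: J_skew.
  - rewrite /stage_set rJ in sat; apply: saturated_connected sat _ M8.
    exact: (stage8_connected J_sq J_anti J_tr FtF FFt).
have Pt8 : Pt 8 = stage8 true.
  apply: chain; first by rewrite Pt0 UE.
  by move=> k k7; have [[]] := Pt_top k k7.
have Pb8 : Pb 8 = stage8 false.
  apply: chain; first by rewrite Pb0 SpE.
  by move=> k k7; have [[]] := Pb_s k k7.
rewrite Pt8 Pb8; split.
  (* The structures defining Sp are among those defining U. *)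
  move=> x [xx xS x2 xJ]; split=> // s Ss; apply: xS.
  by case: Ss => [->|->|[]//]; [constructor 1|constructor 2].
exists 16; split; first by rewrite ltr0n.
exists (bott_map J F); split; first exact: bott_map_isometry.
exact: bott_map_U.
Qed.
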